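(* Let $\Lambda$ be a Bedford--McMullen carpet with non-uniform vertical fibres. There exist $\theta_0,\epsilon,\delta_0>0$ such that for all $\theta\in(0,\theta_0)$ and any cover $\{U_i\}$ of $\Lambda$ that uses at most two scales (i.e. the diameters $|U_i|$ take at most two distinct values), both of which are less than $\delta_0$, we have $\sum_i|U_i|^{\dim_{\theta}\Lambda+\epsilon}\ge1$.
   Context: Carpets. Let $n>m\ge2$ be integers and $\mathcal A\subseteq\{1,\dots,m\}\times\{1,\dots,n\}$ non-empty. For $(i,j)\in\mathcal A$ let $f_{(i,j)}(x,y)=\left(\frac{x+i-1}{m},\frac{y+j-1}{n}\right)$. The Bedford--McMullen carpet $\Lambda$ is the unique non-empty compact set with $\Lambda=\bigcup_{(i,j)\in\mathcal A}f_{(i,j)}(\Lambda)$. The number $M$ of non-empty columns (values $i$ with $(i,j)\in\mathcal A$ for some $j$) is assumed to be $>1$. $\Lambda$ has non-uniform (vertical) fibres if the numbers of maps in the non-empty columns are not all equal. Intermediate dimensions. $|U|$ denotes diameter; covers are finite or countable. For $\theta\in(0,1]$ and bounded non-empty $F\subset\mathbb R^d$, $\underline{\dim}_{\theta}F$ is the infimum of $s\ge0$ such that for all $\varepsilon>0$ and all $\delta_0>0$ there exist $0<\delta\le\delta_0$ and a cover $\{U_i\}$ of $F$ with $\delta^{1/\theta}\le|U_i|\le\delta$ for all $i$ and $\sum_i|U_i|^s\le\varepsilon$. $\overline{\dim}_{\theta}F$ is the infimum of $s\ge0$ such that for all $\varepsilon>0$ there is $\delta_0>0$ such that for all $0<\delta\le\delta_0$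 there is such a cover. For Bedford--McMullen carpets these two coincide, and the common value is denoted $\dim_{\theta}\Lambda$. *)

(* Defs.v *)
From HB Require Import structures.
From mathcomp Require Import all_boot all_order all_algebra.
From mathcomp Require Import all_classical all_reals all_analysis.

Set Implicit Arguments.
Unset Strict Implicit.
Unset Printing Implicit Defensive.

Import Order.TTheory GRing.Theory Num.Theory.
Import numFieldNormedType.Exports.

Local Open Scope classical_set_scope.
Local Open Scope ring_scope.

(* The library norm on 'rV[R]_d is the sup norm, hence the explicit Euclidean
   distance. *)
Definition edist (R : realType) (d : nat) (x y : 'rV[R]_d) : R :=
  Num.sqrt (\sum_(k < d) (x 0 k - y 0 k) ^+ 2).

(* Extended-real valued, so that unbounded sets have diameter +oo; the point 0
   is added so that the empty set has diameter 0 instead of -oo. *)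
Definition diam (R : realType) (d : nat) (A : set 'rV[R]_d) : \bar R :=
  ereal_sup (0%E |` [set (edist p.1 p.2)%:E | p in A `*` A]).

(* Finite or countable families are indexed by an arbitrary I : set nat. *)
Definition covers (R : realType) (d : nat) (F : set 'rV[R]_d)
    (I : set nat) (U : nat -> set 'rV[R]_d) : Prop :=
  F `<=` \bigcup_(i in I) U i.

Definition cost (R : realType) (d : nat) (I : set nat)
    (U : nat -> set 'rV[R]_d) (s : R) : \bar R :=
  \esum_(i in I) poweR (diam (U i)) s.

Definition good_cover (R : realType) (d : nat) (theta : R) (F : set 'rV[R]_d)
    (s eps delta : R) : Prop :=
  exists (I : set nat) (U : nat -> set 'rV[R]_d),
    [/\ covers F I U,
        forall i, I i ->
          ((delta `^ (theta^-1))%:E <= diam (U i) <= delta%:E)%E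
      & (cost I U s <= eps%:E)%E].

Definition lower_intermediate_dim (R : realType) (d : nat) (theta : R)
    (F : set 'rV[R]_d) : R :=
  inf [set s : R | 0 <= s /\
    forall eps delta0 : R, 0 < eps -> 0 < delta0 ->
      exists2 delta : R, 0 < delta <= delta0 & good_cover theta F s eps delta].

Definition upper_intermediate_dim (R : realType) (d : nat) (theta : R)
    (F : set 'rV[R]_d) : R :=
  inf [set s : R | 0 <= s /\
    forall eps : R, 0 < eps -> exists2 delta0 : R, 0 < delta0 &
      forall delta : R, 0 < delta <= delta0 -> good_cover theta F s eps delta].

(* The lower and upper theta-intermediate dimensions of a Bedford-McMullen
   carpet coincide; the upper one is taken as the representative of the common
   value. *)
Definition intermediate_dim (R : realType) (d : nat) (theta : R)
    (F : set 'rV[R]_d) : R :=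
  upper_intermediate_dim theta F.

(* Columns and rows are numbered from 0, so that p = (i - 1, j - 1) stands for
   the pair (i, j) of {1, ..., m} x {1, ..., n}. *)
Definition carpet_map (R : realType) (m n : nat) (p : 'I_m * 'I_n)
    (x : 'rV[R]_2) : 'rV[R]_2 :=
  \row_(k < 2) if k == 0 then (x 0 0 + (p.1 : nat)%:R) / m%:R
               else (x 0 1 + (p.2 : nat)%:R) / n%:R.

Definition is_carpet (R : realType) (m n : nat) (A : {set 'I_m * 'I_n})
    (L : set 'rV[R]_2) : Prop :=
  [/\ L !=set0, compact L
    & L = \bigcup_(p in [set p | p \in A]) (carpet_map p @` L)].

Definition column_size (m n : nat) (A : {set 'I_m * 'I_n}) (i : 'I_m) : nat :=
  #|[set j : 'I_n | (i, j) \in A]%SET|.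

Definition nonempty_columns (m n : nat) (A : {set 'I_m * 'I_n}) : {set 'I_m} :=
  [set i | (0 < column_size A i)%N]%SET.

Definition non_uniform_fibres (m n : nat) (A : {set 'I_m * 'I_n}) : Prop :=
  ~ (forall i i' : 'I_m, i \in nonempty_columns A -> i' \in nonempty_columns A ->
       column_size A i = column_size A i').

(* The two scales are a and b; a cover with a single scale has a = b. *)
Definition at_most_two_scales (R : realType) (d : nat) (I : set nat)
    (U : nat -> set 'rV[R]_d) (a b : R) : Prop :=
  forall i, I i -> diam (U i) = a%:E \/ diam (U i) = b%:E.

(* Main.v *)
Require Import Defs.
From HB Require Import structures.
From mathcomp Require Import all_boot all_order all_algebra.
From mathcomp Require Import all_classical all_reals all_analysis.
From mathcomp Require Import ring lra zify.

Import Order.TTheory GRing.Theory Num.Theory.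
Import numFieldNormedType.Exports.

Local Open Scope classical_set_scope.
Local Open Scope ring_scope.

(** Write N(a) for the number of letters of A in the column of the letter a, put
alpha = ln m / ln n, let Z be the sum over the letters of N(a)^(alpha - 1), and
let h = ln Z / ln m, which is McMullen's value for the Hausdorff dimension of the
carpet.  The theorem compares h with two things: for small theta the intermediate
dimension is at most h + eta / 2, whereas covers by sets of two diameters never do
better than an exponent h + eta, with eta > 0 independent of the diameters.

Scales are measured by approximate squares.  At level k such a square is
described by the first k letters of a code together with the columns of the
letters up to position l, where m^l is comparable to n^k, that is l is the
integer part of k / alpha; it has height n^-k and width at most m n^-k.

Intermediate dimensions (upper_dim_le).  For the product measure with letter
weights N(a)^(alpha - 1) / Z, the logarithm of the mass of the square of level k
around a code w is alpha S(l) - S(k) - l ln Z, where S(k) is the sum of ln N over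
the first k letters of w.  Along the levels k_0, k_1 = l(k_0), k_2 = l(k_1), and
so on, the numbers alpha^j S(k_j) cannot decrease steadily since they are
nonnegative, so within a bounded number J of steps every code meets a level k
where its square has mass at least exp(- k (h + eta) ln n).  At each level there
are at most exp(k (h + eta) ln n) such squares, and together they form a cover
whose cost at an exponent above h + eta is small.  Its diameters lie between
delta and about delta^(alpha^-J), which is allowed once theta is small.

Two scales (two_scale_cost).  Given levels k1 <= k2 with column levels l1 and l2,
the product measure above has entropy about k h ln n at both levels.  Another
choice of letter weights gives equal mass to all columns; since the fibres are
not uniform, it has strictly larger column entropy (col_entropy_lt).  Use it at
the positions from k2 on, and on a short block of positions following k1, whose
length is a small fraction of k1.  The square of level k2 depends on the columns
alone between k2 and l2, so it gains an amount of entropy proportional to k2,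
while the block costs it only a small fraction of that.  The square of level k1
depends on the columns alone from k1 to l1, so the block is a pure gain.  Both
entropies are then at least k (h + 3 eta) ln n (two_scale_mix_entropy).  A
Chernoff bound turns the entropies into bounds on the mass of the squares, off a
set of codes of mass at most 1/2 (two_scale_measure).  Since a set of diameter
at most n^-k meets boundedly many squares of level k, the mass distribution
principle gives the lower bound on the cost.  Sets of diameter 0 cost nothing,
but there are only countably many and every cylinder contains a point of the
carpet outside of them (code_avoiding_sequence). *)

(** * Large deviations for product weights *)

Lemma sum_const_seq (R : realType) (T : Type) (s : seq T) (c : R) :
  \sum_(i <- s) c = (size s)%:R * c.
Proof. by rewrite big_const_seq count_predT iter_addr_0 mulr_natl. Qed.

Section Chernoff.
Context {R : realType} {S : finType}.
Implicit Types (p v : nat -> S -> R).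

Definition word_weight p K (w : {ffun 'I_K -> S}) : R := \prod_(t < K) p t (w t).

Lemma word_weight_sum1 p K : (forall t, \sum_a p t a = 1) ->
  \sum_(w : {ffun 'I_K -> S}) word_weight p K w = 1.
Proof.
move=> p1; rewrite -(bigA_distr_bigA (fun t : 'I_K => p t)).
by rewrite big1.
Qed.

Lemma word_weight_ge0 p K w : (forall t a, 0 <= p t a) -> 0 <= word_weight p K w.
Proof. by move=> p0; apply: prodr_ge0. Qed.

(** The inverse of exp(- u) >= 1 - u; the constant 2 absorbs the tail of the
geometric series. *)
Lemma expR_le_quadratic (u : R) : `|u| <= 2^-1 -> expR u <= 1 + u + 2 * u ^+ 2.
Proof.
rewrite ler_norml => /andP[u1 u2].
have h : 1 - u <= expR (- u) by have := expR_ge1Dx (- u).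
have u0 : 0 < 1 - u by lra.
have -> : expR u = (expR (- u))^-1 by rewrite expRN invrK.
apply: (le_trans (y := (1 - u)^-1)); first by rewrite lef_pV2 ?posrE ?expR_gt0.
rewrite -[X in X <= _]mul1r ler_pdivrMr //.
have := sqr_ge0 u; nra.
Qed.

(** The first order term of the moment generating function is the mean, and the
remainder is quadratic in [la]; for small [la] the mean therefore dominates in
the product over many positions. *)
Lemma letter_mgf (q x : S -> R) (la B : R) :
  (forall a, 0 <= q a) -> \sum_a q a = 1 ->
  (forall a, `|x a| <= B) -> 0 <= la -> la * B <= 2^-1 ->
  \sum_a q a * expR (la * x a)
  <= expR (la * (\sum_a q a * x a) + 2 * la ^+ 2 * B ^+ 2).
Proof.
move=> q0 q1 xB la0 laB.
have step a : q a * expR (la * x a)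
    <= q a + la * (q a * x a) + q a * (2 * la ^+ 2 * B ^+ 2).
  have xa : `|la * x a| <= la * B by rewrite normrM ger0_norm // ler_wpM2l.
  have : x a ^+ 2 <= B ^+ 2.
    by rewrite -real_normK ?num_real // lerXn2r // ?nnegrE // (le_trans _ (xB a)).
  move/(ler_wpM2l (sqr_ge0 la)) => hx.
  have := expR_le_quadratic _ (le_trans xa laB) => he.
  have : expR (la * x a) <= 1 + la * x a + 2 * la ^+ 2 * B ^+ 2 by nra.
  move/(ler_wpM2l (q0 a)) => /le_trans; apply.
  by rewrite le_eqVlt; apply/orP; left; apply/eqP; ring.
apply: (le_trans (ler_sum _ (fun a _ => step a))).
rewrite 2!big_split /= q1 -mulr_sumr -mulr_suml q1 mul1r -addrA.
exact: expR_ge1Dx.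
Qed.

(** Markov's inequality for the exponential of the sum, which factorizes over the
positions.  The bound [B] on the summands depends on the position so that the
positions where they vanish contribute nothing to the error. *)
Lemma chernoff p v K (B : nat -> R) (la Y : R) :
  (forall t a, 0 <= p t a) -> (forall t, \sum_a p t a = 1) ->
  (forall t a, `|v t a| <= B t) -> 0 <= la -> (forall t, la * B t <= 2^-1) ->
  \sum_(w : {ffun 'I_K -> S} | Y <= \sum_(t < K) v t (w t)) word_weight p K w
  <= expR (la * (\sum_(t < K) \sum_a p t a * v t a - Y)
           + 2 * la ^+ 2 * \sum_(t < K) B t ^+ 2).
Proof.
move=> p0 p1 vB la0 laB.
have le1 : \sum_(w : {ffun 'I_K -> S} | Y <= \sum_(t < K) v t (w t))
      word_weight p K w
    <= \sum_(w : {ffun 'I_K -> S})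
      expR (- (la * Y)) * \prod_(t < K) (p t (w t) * expR (la * v t (w t))).
  rewrite [X in X <= _]big_mkcond /=; apply: ler_sum => w _.
  rewrite big_split /= -expR_sum -mulr_sumr mulrCA -expRD.
  have W0 := word_weight_ge0 p K w p0.
  case: ifP => [Yw|_]; last by rewrite mulr_ge0 ?expR_ge0.
  rewrite -{1}[word_weight _ _ _]mulr1 ler_wpM2l //.
  by rewrite -expR0 ler_expR addrC subr_ge0 ler_wpM2l.
apply: (le_trans le1); rewrite -mulr_sumr.
rewrite -(bigA_distr_bigA (fun t : 'I_K => fun a => p t a * expR (la * v t a))).
have le2 : \prod_(t < K) \sum_a p t a * expR (la * v t a)
    <= \prod_(t < K) expR (la * (\sum_a p t a * v t a) + 2 * la ^+ 2 * B t ^+ 2).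
  apply: ler_prod => t _; apply/andP; split.
    by apply: sumr_ge0 => a _; rewrite mulr_ge0 ?expR_ge0.
  exact: letter_mgf.
apply: (le_trans (ler_wpM2l (expR_ge0 _) le2)).
rewrite -expR_sum -expRD ler_expR big_split /= -!mulr_sumr.
by rewrite le_eqVlt; apply/orP; left; apply/eqP; ring.
Qed.

End Chernoff.

(** * Symbolic approximate squares *)

Section Letters.
Context {R : realType} {S : finType} {C : eqType}.
Variables (col : S -> C) (al : R) (a0 : S).

Definition ln_fibre (a : S) : R := ln (#|[pred b | col b == col a]|)%:R.
Definition ln_partition : R := ln (\sum_a expR ((al - 1) * ln_fibre a)).
Definition ln_columns : R := ln (\sum_a expR (- ln_fibre a)).

(** [true] selects the weights that give all columns the same mass, [false] those
of McMullen's measure.  Both distribute the mass of a column evenly over its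
letters. *)
Definition log_letter (T : bool) (a : S) : R :=
  if T then - ln_fibre a - ln_columns else (al - 1) * ln_fibre a - ln_partition.

Definition log_column (T : bool) (a : S) : R := log_letter T a + ln_fibre a.

(** The contribution of position [t] to the logarithm of the mass of an
approximate square of level [k]: letters are specified before [k], columns from
[k] to [l], and nothing after [l]. *)
Definition cyl_log (T : nat -> bool) (k l t : nat) (a : S) : R :=
  if (t < k)%N then log_letter (T t) a else if (t < l)%N then log_column (T t) a else 0.

Definition same_cyl (k l t : nat) (a b : S) : bool :=
  if (t < k)%N then a == b else if (t < l)%N then col a == col b else true.

Definition full_entropy (T : bool) : R := - \sum_a expR (log_letter T a) * log_letter T a.
Definition col_entropy (T : bool) : R := - \sum_a expR (log_letter T a) * log_column T a.

Lemma fibre_gt0 a : (0 < #|[pred b | col b == col a]|)%N.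
Proof. by apply/card_gt0P; exists a; rewrite inE. Qed.

Lemma ln_fibre_ge0 a : 0 <= ln_fibre a.
Proof. by apply: ln_ge0; rewrite ler1n fibre_gt0. Qed.

Lemma expR_ln_fibre a : expR (ln_fibre a) = (#|[pred b | col b == col a]|)%:R.
Proof. by rewrite lnK // posrE ltr0n fibre_gt0. Qed.

Lemma ln_fibre_col a b : col a = col b -> ln_fibre a = ln_fibre b.
Proof. by rewrite /ln_fibre => ->. Qed.

Lemma sum_expR_gt0 (f : S -> R) : 0 < \sum_a expR (f a).
Proof.
rewrite (bigD1 a0) //= ltr_pwDl ?expR_gt0 //.
by apply: sumr_ge0 => a _; exact: expR_ge0.
Qed.

Lemma log_letter_sum1 T : \sum_a expR (log_letter T a) = 1.
Proof.
have norm (f : S -> R) : \sum_a expR (f a - ln (\sum_b expR (f b))) = 1.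
  under eq_bigr do rewrite expRD expRN.
  by rewrite -mulr_suml lnK ?posrE ?sum_expR_gt0 // divff // gt_eqF ?sum_expR_gt0.
by case: T; rewrite /log_letter norm.
Qed.

Lemma log_letter_col T a b : col a = col b -> log_letter T a = log_letter T b.
Proof. by move=> ab; rewrite /log_letter (ln_fibre_col _ _ ab). Qed.

(** All letters of a column have the same weight, and there are as many of them
as the exponential of [ln_fibre]. *)
Lemma log_column_sum T a : \sum_(b | col a == col b) expR (log_letter T b) = expR (log_column T a).
Proof.
rewrite /log_column expRD expR_ln_fibre.
under eq_bigr => b /eqP ab do rewrite -(log_letter_col T _ _ ab).
rewrite sumr_const mulr_natr; congr (_ *+ _).
by apply: eq_card => b; rewrite !inE eq_sym.
Qed.

Lemma same_cyl_mass T k l t a :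
  \sum_(b | same_cyl k l t a b) expR (log_letter (T t) b) = expR (cyl_log T k l t a).
Proof.
rewrite /same_cyl /cyl_log; case: ifP => _.
  by rewrite (big_pred1 a) // => b; rewrite eq_sym.
by case: ifP => _; [exact: log_column_sum | rewrite log_letter_sum1 expR0].
Qed.

(** The square containing [w] is a product set, so its mass is a product over the
positions. *)
Lemma cylinder_mass T k l K (w : {ffun 'I_K -> S}) :
  \sum_(w' : {ffun 'I_K -> S} | [forall t : 'I_K, same_cyl k l t (w t) (w' t)])
     word_weight (fun t a => expR (log_letter (T t) a)) K w'
  = expR (\sum_(t < K) cyl_log T k l t (w t)).
Proof.
rewrite expR_sum.
transitivity (\prod_(t < K) \sum_(b | same_cyl k l t (w t) b) expR (log_letter (T t) b)).
  rewrite bigA_distr_big_dep; apply: eq_bigl => w'.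
  by apply/forallP/familyP.
by apply: eq_bigr => t _; rewrite same_cyl_mass.
Qed.

End Letters.

(** * Entropy of a mixture of McMullen and uniform columns *)

Section Entropy.
Context {R : realType} {S : finType} {C : eqType}.
Variables (col : S -> C) (al : R) (a0 : S).
Hypothesis al01 : 0 < al < 1.

Local Notation ln_fibre := (@ln_fibre R S C col).
Local Notation ln_partition := (ln_partition col al).
Local Notation ln_columns := (@ln_columns R S C col).
Local Notation log_letter := (log_letter col al).
Local Notation log_column := (log_column col al).
Local Notation cyl_log := (cyl_log col al).
Local Notation full_entropy := (full_entropy col al).
Local Notation col_entropy := (col_entropy col al).
Local Notation mean_ln_fibre := (\sum_a expR (log_letter false a) * ln_fibre a).

Lemma mean_ln_fibre_ge0 : 0 <= mean_ln_fibre.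
Proof. by apply: sumr_ge0 => a _; rewrite mulr_ge0 ?expR_ge0 ?ln_fibre_ge0. Qed.

(** The logarithms of the weights are affine functions of [ln_fibre], which
reduces every entropy to the mean of the latter. *)
Lemma mean_affine T c d (f g : S -> R) : (forall a, g a = c + d * f a) ->
  \sum_a expR (log_letter T a) * g a
  = c + d * \sum_a expR (log_letter T a) * f a.
Proof.
move=> gE; under eq_bigr do rewrite gE mulrDr mulrCA.
by rewrite big_split /= -mulr_suml log_letter_sum1 // mul1r -mulr_sumr.
Qed.

Lemma full_entropy_mcmullen : full_entropy false = ln_partition + (1 - al) * mean_ln_fibre.
Proof.
rewrite /full_entropy (mean_affine false (- ln_partition) (al - 1) ln_fibre); first by ring.
by move=> a; rewrite /log_letter; ring.
Qed.

Lemma col_entropy_mcmullen : col_entropy false = ln_partition - al * mean_ln_fibre.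
Proof.
rewrite /col_entropy (mean_affine false (- ln_partition) al ln_fibre); first by ring.
by move=> a; rewrite /log_column /log_letter; ring.
Qed.

Lemma col_entropy_uniform : col_entropy true = ln_columns.
Proof.
rewrite /col_entropy (mean_affine true (- ln_columns) 0 ln_fibre); first by ring.
by move=> a; rewrite /log_column /log_letter; ring.
Qed.

(** The letters of a single column already contribute N^alpha >= 1 to the
partition sum. *)
Lemma ln_partition_ge0 : 0 <= ln_partition.
Proof.
apply: ln_ge0; apply: (le_trans (y := \sum_(b | col b == col a0) expR ((al - 1) * ln_fibre b))).
  rewrite (eq_bigr (fun=> expR ((al - 1) * ln_fibre a0))); last first.
    by move=> b /eqP ba; rewrite (ln_fibre_col col _ _ ba).
  rewrite sumr_const -mulr_natr.
  rewrite (_ : _%:R = expR (ln_fibre a0)); last first.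
    by rewrite expR_ln_fibre; congr (_%:R); apply: eq_card.
  rewrite -expRD -[X in X <= _]expR0 ler_expR; have := ln_fibre_ge0 (R := R) col a0.
  by move: al01 => /andP[? ?] ?; nra.
rewrite [X in _ <= X](bigID (fun b => col b == col a0)) /= lerDl.
by apply: sumr_ge0 => b _; exact: expR_ge0.
Qed.

(** The difference is the relative entropy of the McMullen weights with respect to
the uniform column weights, because both are uniform within columns.  It is
positive by the strict inequality exp(- x) > 1 - x at a letter where the two
weights differ, and the weights coincide only if N^alpha is constant. *)
Lemma col_entropy_lt a b : ln_fibre a != ln_fibre b ->
  col_entropy false < col_entropy true.
Proof.
move=> nab; rewrite -subr_gt0.
pose x a := al * ln_fibre a - ln_partition + ln_columns.
have -> : col_entropy true - col_entropy false
    = \sum_a expR (log_letter false a) * x a.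
  rewrite col_entropy_uniform col_entropy_mcmullen.
  rewrite (mean_affine false (ln_columns - ln_partition) al ln_fibre x); first by ring.
  by move=> c; rewrite /x; ring.
have [c xc] : exists c, x c != 0.
  have [xa0|] := eqVneq (x a) 0; last by exists a.
  exists b; apply: contra_neq nab => xb0.
  have /mulfI : al != 0 by move/andP: al01 => [/gt_eqF ->].
  apply; move: xa0 xb0; rewrite /x; lra.
have le1 d : expR (log_letter false d) * (1 - x d) <= expR (log_letter true d).
  (* exp(- x) is the ratio of the uniform weight to the McMullen weight *)
  have -> : log_letter true d = log_letter false d + - x d by rewrite /log_letter /x; ring.
  by rewrite expRD ler_wpM2l ?expR_ge0 // expR_ge1Dx.
have lt1 : expR (log_letter false c) * (1 - x c) < expR (log_letter true c).
  have -> : log_letter true c = log_letter false c + - x c by rewrite /log_letter /x; ring.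
  by rewrite expRD ltr_pM2l ?expR_gt0 // expR_gt1Dx // oppr_eq0.
have : \sum_d expR (log_letter false d) * (1 - x d) < \sum_d expR (log_letter true d).
  rewrite (bigD1 c) //= [X in _ < X](bigD1 c) //= ltr_leD //.
  by apply: ler_sum => d _; exact: le1.
rewrite log_letter_sum1 //; under eq_bigr do rewrite mulrBr mulr1.
by rewrite sumrB log_letter_sum1 // ltrBlDr ltrDl.
Qed.

Lemma mean_cyl_log (T : nat -> bool) k l K : (k <= l)%N -> (l <= K)%N ->
  \sum_(t < K) \sum_a expR (log_letter (T t) a) * cyl_log T k l t a
  = - (\sum_(0 <= t < k) full_entropy (T t)
       + \sum_(k <= t < l) col_entropy (T t)).
Proof.
move=> kl lK.
rewrite -(big_mkord xpredT (fun t => \sum_a expR (log_letter (T t) a) * cyl_log T k l t a)).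
rewrite (big_cat_nat (n := l)) //= (big_cat_nat (n := k)) //=.
rewrite [X in _ + X = _]big_nat_cond [X in _ + X = _]big1 ?addr0; last first.
  move=> t /andP[/andP[lt _] _]; apply: big1 => a _.
  by rewrite /cyl_log !ltnNge lt (leq_trans kl lt) /= mulr0.
rewrite opprD -!sumrN; congr (_ + _); apply: eq_big_nat => t /andP[t1 t2].
  by rewrite opprK; apply: eq_bigr => a _; rewrite /cyl_log t2.
by rewrite opprK; apply: eq_bigr => a _; rewrite /cyl_log ltnNge t1 t2.
Qed.

Lemma sum_ge_const (f : nat -> R) (i j : nat) (c : R) : (i <= j)%N ->
  (forall t, (i <= t < j)%N -> c <= f t) ->
  (j%:R - i%:R) * c <= \sum_(i <= t < j) f t.
Proof.
move=> ij cf; rewrite -natrB // mulr_natl -sumr_const_nat.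
by rewrite ler_sum_nat.
Qed.

(** The positions with uniform columns: a block of length k1 / D that serves the
coarse level [k1], and everything from the fine level [k2] on. *)
Definition two_scale_mix (D k1 k2 t : nat) : bool :=
  ((k1 <= t) && (t < k1 + k1 %/ D))%N || (k2 <= t)%N.

(** [l] is the integer part of [k / al], the number of columns specified at
level [k]. *)
Definition level_pair (k l : nat) : Prop := al * l%:R <= k%:R < al * l.+1%:R.

Lemma level_pair_le k l : level_pair k l -> (k <= l)%N.
Proof.
move=> /andP[_ lk]; rewrite -ltnS -(ltr_nat R); apply: lt_trans lk _.
by rewrite -[ltRHS]mul1r ltr_pM2r ?ltr0n //; case/andP: al01.
Qed.

Definition scale_entropy (T : nat -> bool) k l : R :=
  \sum_(0 <= t < k) full_entropy (T t) + \sum_(k <= t < l) col_entropy (T t).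

(** With McMullen weights only, the entropy at level [k] is
l ln Z + (k - al l) E with E >= 0 the mean of [ln_fibre], hence at least
(k / al - 1) ln Z.  The uniform columns improve it by a fixed multiple of [k] at
both levels, provided that [D] is large; the rounding errors are absorbed
once [k1] is large. *)
Lemma two_scale_mix_entropy a b : ln_fibre a != ln_fibre b ->
  exists2 ka : R, 0 < ka & exists D ks : nat, forall k1 k2 l1 l2,
    (ks <= k1)%N -> (k1 <= k2)%N -> level_pair k1 l1 -> level_pair k2 l2 ->
    (ln_partition / al + 3 * ka) * k1%:R <= scale_entropy (two_scale_mix D k1 k2) k1 l1 /\
    (ln_partition / al + 3 * ka) * k2%:R <= scale_entropy (two_scale_mix D k1 k2) k2 l2.
Proof.
move=> nab.
have := full_entropy_mcmullen; have := col_entropy_mcmullen.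
have := mean_ln_fibre_ge0; have := col_entropy_lt _ _ nab; have := ln_partition_ge0.
set Z := ln_partition; set E := mean_ln_fibre.
set Hp := full_entropy false; set Hq := col_entropy false; set Hu := col_entropy true.
move=> Z0 HqHu E0 HqE HpE.
pose c0 := Hu - Hq.
have c0_gt0 : 0 < c0 by rewrite subr_gt0.
pose C' := `|Hp - full_entropy true| + 1.
have C'0 : 0 < C' by rewrite ltr_wpDl.
have HC' : Hp - C' <= full_entropy true.
  by rewrite /C'; have := ler_norm (Hp - full_entropy true); lra.
have [al0 al1] : 0 < al /\ al < 1 by apply/andP.
pose g := al^-1.
have alg : al * g = 1 by rewrite /g divff ?gt_eqF.
have g1 : 1 < g by rewrite /g invf_gt1.
pose rho0 := (g - 1) / 2.
have rho00 : 0 < rho0 by rewrite /rho0; lra.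
(* D is large enough for the entropy lost at the fine scale to be at most half
   of the entropy gained there *)
have [D D0 HD] : exists2 D : nat, (0 < D)%N & C' / D%:R <= c0 * rho0.
  pose X := C' / (c0 * rho0).
  have X0 : 0 < X by apply: divr_gt0 => //; apply: mulr_gt0.
  exists (Num.truncn X).+1 => //.
  rewrite ler_pdivrMr ?ltr0n // mulrC -ler_pdivrMr; last exact: mulr_gt0.
  by rewrite ltW // truncnS_gt.
pose rho := Num.min (D%:R^-1) rho0.
have rhoD : rho <= D%:R^-1 by rewrite ge_min lexx.
have rhor : rho <= rho0 by rewrite ge_min lexx orbT.
have rho_gt0 : 0 < rho by rewrite lt_min invr_gt0 ltr0n D0.
pose ka := c0 * rho / 6.
have ka0 : 0 < ka by rewrite divr_gt0 ?mulr_gt0.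
pose ks := (Num.truncn ((c0 + Z) / (3 * ka))).+1.
exists ka => //; exists D, ks => k1 k2 l1 l2 ksk k12 L1 L2.
have big k : (ks <= k)%N -> c0 + Z <= 3 * ka * k%:R.
  rewrite -(ler_nat R) => hk; rewrite mulrC -ler_pdivrMr; last by apply: mulr_gt0.
  by apply: le_trans hk; rewrite ltW // truncnS_gt.
have lev k l : level_pair k l -> (l%:R : R) * al <= k%:R /\ g * k%:R - 1 <= l%:R.
  case/andP => h1 h2; split; first by rewrite mulrC.
  have : g * k%:R < g * (al * l.+1%:R) by rewrite ltr_pM2l // (lt_trans ltr01).
  by rewrite mulrA (mulrC g al) alg mul1r -natr1 => h; lra.
(* entropy of the McMullen weights alone *)
have base k l : level_pair k l ->
    (Z / al) * k%:R - Z <= k%:R * Hp + (l%:R - k%:R) * Hq.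
  move=> /lev[h1 h2]; rewrite HpE HqE -/g.
  have : (l%:R * al) * E <= k%:R * E by rewrite ler_wpM2r.
  have : Z * (g * k%:R - 1) <= Z * l%:R by rewrite ler_wpM2l.
  by nra.
have kl1 := level_pair_le _ _ L1; have kl2 := level_pair_le _ _ L2.
pose e := (k1 %/ D)%N.
have eD : e%:R <= k1%:R / D%:R :> R.
  by rewrite ler_pdivlMr ?ltr0n // -natrM ler_nat leq_trunc_div.
have eD' : k1%:R * rho - 1 <= e%:R.
  have : k1%:R <= (e%:R + 1) * D%:R :> R.
    by rewrite natr1 -natrM ler_nat ltnW // -ltn_divLR.
  rewrite -ler_pdivrMr ?ltr0n // => h.
  have : k1%:R * rho <= k1%:R / D%:R by rewrite ler_wpM2l.
  by lra.
split.
- (* coarse scale: the first block of uniform columns is a pure gain *)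
  have /lev[h1 h2] := L1.
  (* the block may extend beyond l1, where the coarse square sees nothing *)
  pose r := minn (k1 + e) l1.
  have rl : (r <= l1)%N by rewrite geq_minr.
  have kr : (k1 <= r)%N by rewrite leq_min leq_addr kl1.
  rewrite /scale_entropy (big_cat_nat (m := k1) (n := r)) //=.
  have s1 : (k1%:R - 0) * Hp
      <= \sum_(0 <= t < k1) full_entropy (two_scale_mix D k1 k2 t).
    apply: (sum_ge_const _ 0) => // t /andP[_ tk].
    by rewrite /two_scale_mix leqNgt tk /= leqNgt (leq_trans tk k12).
  have s2 : (r%:R - k1%:R) * Hu
      <= \sum_(k1 <= t < r) col_entropy (two_scale_mix D k1 k2 t).
    apply: sum_ge_const => // t /andP[kt]; rewrite leq_min => /andP[tr _].
    by rewrite /two_scale_mix kt tr.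
  have s3 : (l1%:R - r%:R) * Hq
      <= \sum_(r <= t < l1) col_entropy (two_scale_mix D k1 k2 t).
    apply: sum_ge_const => // t _.
    by case: (two_scale_mix _ _ _ _) => //; exact: ltW.
  have hr : k1%:R * rho - 1 <= r%:R - k1%:R.
    rewrite /r /minn; case: ifP => _; first by rewrite natrD; lra.
    have : k1%:R * rho <= k1%:R * rho0 by rewrite ler_wpM2l.
    rewrite /rho0 => h; suff : 0 <= k1%:R * rho0 by rewrite /rho0; lra.
    by rewrite mulr_ge0 // ltW.
  have := base _ _ L1.
  have : c0 * (k1%:R * rho - 1) <= c0 * (r%:R - k1%:R) by rewrite ler_wpM2l // ltW.
  have := big _ ksk; rewrite /ka => b1 b2 b3.
  apply: le_trans (lerD s1 (lerD s2 s3)).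
  move: b2; rewrite /c0 in b1 b3 *; nra.
- (* fine scale: the loss on the first block is dominated by the final block *)
  have /lev[h1 h2] := L2.
  pose r := minn (k1 + e) k2.
  have rl : (r <= k2)%N by rewrite geq_minr.
  have kr : (k1 <= r)%N by rewrite leq_min leq_addr k12.
  rewrite /scale_entropy (big_cat_nat (n := k1)) //= (big_cat_nat (m := k1) (n := r)) //=.
  have s1 : (k1%:R - 0) * Hp
      <= \sum_(0 <= t < k1) full_entropy (two_scale_mix D k1 k2 t).
    apply: (sum_ge_const _ 0) => // t /andP[_ tk].
    by rewrite /two_scale_mix leqNgt tk /= leqNgt (leq_trans tk k12).
  have s2 : (r%:R - k1%:R) * (Hp - C')
      <= \sum_(k1 <= t < r) full_entropy (two_scale_mix D k1 k2 t).
    apply: sum_ge_const => // t _.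
    by case: (two_scale_mix _ _ _ _) => //; rewrite gerBl ltW.
  have s3 : (k2%:R - r%:R) * Hp
      <= \sum_(r <= t < k2) full_entropy (two_scale_mix D k1 k2 t).
    apply: sum_ge_const => // t /andP[rt tk].
    rewrite /two_scale_mix [(k2 <= t)%N]leqNgt tk orbF ltnNge.
    by move: rt; rewrite /r geq_min [(k2 <= t)%N]leqNgt tk orbF => ->; rewrite andbF.
  have s4 : (l2%:R - k2%:R) * Hu
      <= \sum_(k2 <= t < l2) col_entropy (two_scale_mix D k1 k2 t).
    apply: sum_ge_const => // t /andP[kt _].
    by rewrite /two_scale_mix kt orbT.
  have hr : (r%:R - k1%:R) * C' <= c0 * (k2%:R * rho0).
    have hr1 : r%:R - k1%:R <= k2%:R / D%:R :> R.
      apply: (le_trans (y := e%:R)); last first.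
        by apply: (le_trans eD); rewrite ler_wpM2r ?ler_nat.
      by rewrite lerBlDl -natrD ler_nat geq_minl.
    apply: (le_trans (ler_wpM2r (ltW C'0) hr1)).
    have : k2%:R * (C' / D%:R) <= k2%:R * (c0 * rho0) by rewrite ler_wpM2l.
    by nra.
  have := base _ _ L2.
  have : c0 * (2 * (k2%:R * rho0) - 1) <= c0 * (l2%:R - k2%:R).
    by rewrite ler_wpM2l ?(ltW c0_gt0) // /rho0; lra.
  have : c0 * (k2%:R * rho) <= c0 * (k2%:R * rho0).
    by rewrite !ler_wpM2l // ltW.
  have := big _ (leq_trans ksk k12); rewrite /ka => b1 b0 b2 b3.
  apply: le_trans (lerD (lerD s1 (lerD s2 s3)) s4).
  move: b2; rewrite /c0 in b0 b1 b3 hr *; nra.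
Qed.

End Entropy.

(** * A measure adapted to two scales *)

Section TwoScaleMeasure.
Context {R : realType} {S : finType} {C : eqType}.
Variables (col : S -> C) (al : R) (a0 : S).
Hypothesis al01 : 0 < al < 1.

Local Notation ln_fibre := (@ln_fibre R S C col).
Local Notation ln_partition := (ln_partition col al).
Local Notation log_letter := (log_letter col al).
Local Notation log_column := (log_column col al).
Local Notation cyl_log := (cyl_log col al).
Local Notation level_pair := (level_pair al).

Lemma cyl_log_bounded : exists2 B : R, 0 < B &
  forall T k l t a, `|cyl_log T k l t a| <= if (t < maxn k l)%N then B else 0.
Proof.
pose f (x : S * bool) := `|log_letter x.2 x.1| + `|log_column x.2 x.1|.
have f0 x : 0 <= f x by rewrite addr_ge0.
exists (1 + \sum_x f x) => [|T k l t a].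
  by rewrite ltr_pwDl // sumr_ge0.
have fB : f (a, T t) <= 1 + \sum_x f x.
  rewrite (bigD1 (a, T t)) //= addrCA lerDl addr_ge0 //.
  by apply: sumr_ge0.
rewrite /cyl_log leq_max; case: ifP => tk /=.
  by apply: le_trans fB; rewrite lerDl.
by case: ifP => tl; [apply: le_trans fB; rewrite lerDr | rewrite normr0].
Qed.

Lemma level_pair_homo k1 k2 l1 l2 :
  (k1 <= k2)%N -> level_pair k1 l1 -> level_pair k2 l2 -> (l1 <= l2)%N.
Proof.
move=> k12 /andP[h _] /andP[_ h']; rewrite -ltnS -(ltr_nat R).
have [al0 _] := andP al01; rewrite -(ltr_pM2l al0).
by apply: le_lt_trans h (le_lt_trans _ h'); rewrite ler_nat.
Qed.

(** Each level excludes codes of mass at most 1/4 by the Chernoff bound.  The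
entropy exceeds the required exponent by [ka * k], and the quadratic error, at
most 2 la^2 B^2 k / al, is half as large as the resulting gain for the choice
of [la]. *)
Lemma two_scale_measure a b : ln_fibre a != ln_fibre b ->
  exists2 ka : R, 0 < ka & exists ks : nat, forall k1 k2 l1 l2 K,
    (ks <= k1)%N -> (k1 <= k2)%N -> level_pair k1 l1 -> level_pair k2 l2 -> (l2 <= K)%N ->
    exists (W : {ffun 'I_K -> S} -> R) (G : pred {ffun 'I_K -> S}),
      [/\ forall w, 0 <= W w, 2^-1 <= \sum_(w | G w) W w &
        forall w k l, G w -> (k, l) = (k1, l1) \/ (k, l) = (k2, l2) ->
          \sum_(w' : {ffun 'I_K -> S}
                 | [forall t : 'I_K, same_cyl col k l t (w t) (w' t)]) W w'
          <= expR (- (ln_partition / al + 2 * ka) * k%:R)].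
Proof.
move=> /(two_scale_mix_entropy col al a0 al01)[ka ka0 [D [ks H]]].
have [B B0 vB] := cyl_log_bounded.
have [al0 al1] : 0 < al /\ al < 1 by apply/andP.
pose la := Num.min (2 * B)^-1 (ka * al / (4 * B ^+ 2)).
have la0 : 0 < la.
  rewrite lt_min invr_gt0 mulr_gt0 //= divr_gt0 ?mulr_gt0 //.
have la1 : la * B <= 2^-1.
  have : la <= (2 * B)^-1 by rewrite ge_min lexx.
  move/(ler_wpM2r (ltW B0)) => /le_trans; apply.
  by rewrite invfM -mulrA mulVf ?mulr1 // gt_eqF.
have la2 : la * (4 * B ^+ 2) <= ka * al.
  by rewrite -ler_pdivlMr ?ge_min ?lexx ?orbT // mulr_gt0 // exprn_gt0.
exists ka => //.
pose ks' := (Num.truncn (6 / (la * ka))).+1.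
exists (maxn ks ks') => k1 k2 l1 l2 K; rewrite geq_max => /andP[hks hks'] k12 L1 L2 l2K.
pose T := two_scale_mix D k1 k2.
pose p t a := expR (log_letter (T t) a).
pose W (w : {ffun 'I_K -> S}) := word_weight p K w.
pose bad k l := fun w : {ffun 'I_K -> S} =>
  - (ln_partition / al + 2 * ka) * k%:R <= \sum_(t < K) cyl_log T k l t (w t).
have W0 w : 0 <= W w by apply: word_weight_ge0 => t c; exact: expR_ge0.
have p1 t : \sum_c p t c = 1 by exact: log_letter_sum1.
have l12 := level_pair_homo _ _ _ _ k12 L1 L2.
have badP k l : (ks' <= k)%N -> level_pair k l -> (l <= K)%N ->
    (ln_partition / al + 3 * ka) * k%:R <= scale_entropy col al T k l ->
    \sum_(w | bad k l w) W w <= 4^-1.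
  move=> kk L lK E; have kl := level_pair_le _ al01 _ _ L.
  have la1' t : la * (if (t < maxn k l)%N then B else 0) <= 2^-1.
    by case: ifP => // _; rewrite mulr0 invr_ge0.
  apply: le_trans (chernoff p (cyl_log T k l) K _ la _
     (fun t a => expR_ge0 _) p1 (vB T k l) (ltW la0) la1') _.
  rewrite mean_cyl_log // -/(scale_entropy _ _ _ _ _).
  have sumB : \sum_(t < K) (if (t < maxn k l)%N then B else 0) ^+ 2 <= l%:R * B ^+ 2.
    rewrite (maxn_idPr kl).
    rewrite -(big_mkord xpredT (fun t => (if (t < l)%N then B else 0) ^+ 2)).
    rewrite (big_cat_nat (n := l)) //= [X in _ + X]big_nat_cond.
    rewrite [X in _ + X]big1 ?addr0; last first.
      by move=> t /andP[/andP[lt _] _]; rewrite ltnNge lt expr0n.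
    rewrite (eq_big_nat _ _ (F2 := fun=> B ^+ 2)); last by move=> t /andP[_ ->].
    by rewrite sumr_const_nat subn0 mulr_natl.
  (* the threshold ks' makes the exponent at most -3, and exp(-3) <= 1/4 *)
  have k6 : 6 <= la * ka * k%:R.
    rewrite mulrC -ler_pdivrMr ?mulr_gt0 //.
    by apply: (le_trans (y := ks'%:R)); [rewrite ltW // truncnS_gt | rewrite ler_nat].
  have lk : l%:R * al <= k%:R by case/andP: L; rewrite mulrC.
  have quad : 2 * la ^+ 2 * (l%:R * B ^+ 2) <= la * ka * k%:R / 2.
    have : la * (4 * B ^+ 2) * (l%:R * la) <= ka * al * (l%:R * la).
      by rewrite ler_wpM2r // mulr_ge0 // ltW.
    have : la * ka * (l%:R * al) <= la * ka * k%:R.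
      by rewrite ler_wpM2l // mulr_ge0 // ltW.
    by nra.
  have lin : la * (- scale_entropy col al T k l - - (ln_partition / al + 2 * ka) * k%:R)
      <= - (la * ka * k%:R).
    have := ler_wpM2l (ltW la0) E; by nra.
  have q2 : 2 * la ^+ 2 * \sum_(t < K) (if (t < maxn k l)%N then B else 0) ^+ 2
      <= la * ka * k%:R / 2.
    by apply: le_trans quad; rewrite ler_wpM2l // mulr_ge0 // sqr_ge0.
  apply: (le_trans (y := expR (- 3))).
    rewrite ler_expR; apply: (le_trans (lerD lin q2)); lra.
  rewrite expRN lef_pV2 ?posrE ?expR_gt0 //.
  by have := expR_ge1Dx (3 : R); lra.
have [E1 E2] := H _ _ _ _ hks k12 L1 L2.
have b1 := badP _ _ hks' L1 (leq_trans l12 l2K) E1.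
have b2 := badP _ _ (leq_trans hks' k12) L2 l2K E2.
exists W, (fun w => ~~ bad k1 l1 w && ~~ bad k2 l2 w); split => //.
- have : \sum_w W w = 1 by exact: word_weight_sum1.
  rewrite (bigID (bad k1 l1)) /= => sum1.
  have s2 : \sum_(w | ~~ bad k1 l1 w) W w
    <= \sum_(w | bad k2 l2 w) W w + \sum_(w | ~~ bad k1 l1 w && ~~ bad k2 l2 w) W w.
    rewrite (bigID (bad k2 l2)) /= lerD2r.
    rewrite [X in X <= _]big_mkcond [X in _ <= X]big_mkcond /=.
    by apply: ler_sum => w _; case: (bad k2 l2 w); rewrite ?andbF ?andbT //; case: ifP.
  lra.
- move=> w k l /andP[n1 n2] kl; rewrite (cylinder_mass col al a0 T) ler_expR ltW // ltNge.
  by case: kl => -[-> ->].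
Qed.

End TwoScaleMeasure.

(** * Levels of large McMullen mass *)

Section GoodScales.
Context {R : realType} {S : finType} {C : eqType}.
Variables (col : S -> C) (al : R) (a0 : S).
Hypothesis al01 : 0 < al < 1.

Local Notation ln_fibre := (@ln_fibre R S C col).
Local Notation ln_partition := (ln_partition col al).
Local Notation log_letter := (log_letter col al).
Local Notation cyl_log := (cyl_log col al).
Local Notation level_pair := (level_pair al).

Definition mcmullen_log (k l : nat) (w : nat -> S) : R :=
  \sum_(0 <= t < l) cyl_log (fun=> false) k l t (w t).

Lemma mcmullen_logE k l w : (k <= l)%N ->
  mcmullen_log k l w = al * \sum_(0 <= t < l) ln_fibre (w t)
    - \sum_(0 <= t < k) ln_fibre (w t) - l%:R * ln_partition.
Proof.
move=> kl; have constE : l%:R * ln_partition = \sum_(0 <= t < l) ln_partition.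
  by rewrite sumr_const_nat subn0 mulr_natl.
rewrite constE mulr_sumr /mcmullen_log.
rewrite !(big_cat_nat (m := 0) (n := k) (p := l)) //=.
rewrite (eq_big_nat _ _ (F2 := fun t => al * ln_fibre (w t) - ln_fibre (w t) - ln_partition)); last first.
  by move=> t /andP[_ tk]; rewrite /cyl_log tk /log_letter; ring.
rewrite [X in _ + X = _](eq_big_nat _ _ (F2 := fun t => al * ln_fibre (w t) - ln_partition)).
  by rewrite !sumrB; ring.
move=> t /andP[kt tl]; rewrite /cyl_log ltnNge kt tl /= /log_column /log_letter; ring.
Qed.

Lemma ln_fibre_le a : ln_fibre a <= ln #|S|%:R.
Proof.
by rewrite ler_ln ?posrE ?ltr0n ?fibre_gt0 // ?ler_nat ?max_card //; apply/card_gt0P; exists a.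
Qed.

(** Failure at the level [k j] means that al S(k (j+1)) <= S(k j) - eta (k j),
where S is the sum of [ln_fibre] over an initial segment of the code.
Multiplying by al^j and adding up, the nonnegative quantity al^J S(k J) is at
most S(k 0) - eta J (k 0 - J), because al^j (k j) differs from [k 0] by at most
[j], through rounding.  As S(k 0) <= (k 0) ln #|S|, this is impossible for large
[J]. *)
Lemma exists_good_scale (eta : R) (J : nat) (k : nat -> nat) (w : nat -> S) :
  0 < eta -> 2 * ln #|S|%:R < J%:R * eta -> (2 * J <= k 0)%N ->
  (forall j, level_pair (k j) (k j.+1)) ->
  exists2 j, (j < J)%N &
    - (ln_partition / al + eta) * (k j)%:R <= mcmullen_log (k j) (k j.+1) w.
Proof.
move=> eta0 Jeta k0J lev; have [al0 al1] : 0 < al /\ al < 1 by apply/andP.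
pose SN l := \sum_(0 <= t < l) ln_fibre (w t).
apply: contrapT => nex.
have fail j : (j < J)%N -> al * SN (k j.+1) <= SN (k j) - eta * (k j)%:R.
  move=> jJ; rewrite leNgt; apply/negP => h; apply: nex; exists j => //.
  rewrite mcmullen_logE; last exact: level_pair_le (lev j).
  have : ln_partition * ((k j.+1)%:R * al) <= ln_partition * (k j)%:R.
    rewrite ler_wpM2l ?(ln_partition_ge0 _ _ a0) //.
    by have /andP[] := lev j; rewrite mulrC.
  rewrite -(ler_pM2r (x := al^-1)) ?invr_gt0 // -!mulrA divff ?gt_eqF // mulr1.
  by move: h; rewrite /SN; lra.
have len j : (k 0)%:R - j%:R <= al ^+ j * (k j)%:R.
  elim: j => [|j IH]; first by rewrite expr0 mul1r subr0.
  have /andP[_] := lev j; rewrite -natr1 => h.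
  have aj0 : 0 <= al ^+ j by rewrite exprn_ge0 // ltW.
  have aj1 : al ^+ j <= 1 by rewrite exprn_ile1 // ltW.
  have := ler_wpM2l aj0 (ltW h); rewrite exprS -natr1.
  have : al ^+ j * al <= 1 by rewrite mulr_ile1 // ltW.
  by nra.
have tele j : (j <= J)%N ->
    al ^+ j * SN (k j) + j%:R * (eta * ((k 0)%:R - J%:R)) <= SN (k 0).
  elim: j => [|j IH] jJ; first by rewrite expr0 mul1r mul0r addr0.
  apply: le_trans _ (IH (ltnW jJ)); rewrite exprSr -mulrA -[X in X%:R]addn1 natrD.
  have aj0 : 0 <= al ^+ j by rewrite exprn_ge0 // ltW.
  have := ler_wpM2l aj0 (fail j jJ).
  have : eta * ((k 0)%:R - J%:R) <= eta * (al ^+ j * (k j)%:R).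
    rewrite (ler_wpM2l (ltW eta0)) //; apply: le_trans _ (len j).
    by rewrite lerB // ler_nat ltnW.
  by nra.
have := tele J (leqnn J).
have SN0 l : 0 <= SN l by apply: sumr_ge0 => t _; exact: ln_fibre_ge0.
have SNle : SN (k 0) <= (k 0)%:R * ln #|S|%:R.
  rewrite mulr_natl -[X in _ *+ X]subn0 -sumr_const_nat.
  by apply: ler_sum => t _; exact: ln_fibre_le.
have J0 : (0 < J)%N.
  rewrite lt0n; apply/eqP => J0; move: Jeta; rewrite J0 mul0r.
  have := ln_ge0 (x := #|S|%:R : R); rewrite ler1n.
  have -> : (0 < #|S|)%N by apply/card_gt0P; exists a0.
  by move=> /(_ isT); lra.
have hk : 2 * J%:R <= (k 0)%:R :> R by rewrite -natrM ler_nat.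
have hJ : 0 < J%:R :> R by rewrite ltr0n.
have k0 : 0 < (k 0)%:R :> R by lra.
have := SN0 (k J); move/(mulr_ge0 (exprn_ge0 J (ltW al0))).
have : (k 0)%:R * (2 * ln #|S|%:R) < (k 0)%:R * (J%:R * eta).
  by rewrite ltr_pM2l.
have : J%:R * eta * ((k 0)%:R / 2) <= J%:R * eta * ((k 0)%:R - J%:R).
  by apply: ler_wpM2l; [rewrite mulr_ge0 // ltW | lra].
by nra.
Qed.

(** Both the counting of squares and the mass distribution principle regroup the
words according to the value of a map. *)
Lemma sum_over_values (T : finType) (D : eqType) (s : seq D) (f : T -> D)
    (P : pred T) (W : T -> R) : uniq s ->
  \sum_(c <- s) \sum_(w | P w && (f w == c)) W w = \sum_(w | P w && (f w \in s)) W w.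
Proof.
move=> us; rewrite (exchange_big_dep P) /=; last by move=> c w _ /andP[].
rewrite big_mkcondr; apply: eq_bigr => w Pw; rewrite Pw /=.
rewrite -big_filter (eq_filter (a2 := pred1 (f w))); last by move=> c; rewrite /= eq_sym.
case: ifPn => fs; first by rewrite filter_pred1_uniq // big_seq1.
rewrite (_ : seq.filter _ _ = [::]) ?big_nil //.
by apply/eqP; rewrite -[_ == _]negbK -has_filter has_pred1.
Qed.

(** Squares with different codes are disjoint and the total mass is 1, so at most
e^X of them have mass at least e^-X. *)
Lemma count_codes (D : eqType) K (k l : nat) (X : R) (code : {ffun 'I_K -> S} -> D) :
  (forall w w' : {ffun 'I_K -> S},
     (forall t : 'I_K, same_cyl col k l t (w t) (w' t)) -> code w = code w') ->
  (size (undup [seq code w | w : {ffun 'I_K -> S} <- enum {: {ffun 'I_K -> S}} &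
      - X <= \sum_(t < K) cyl_log (fun=> false) k l t (w t)]))%:R <= expR X.
Proof.
move=> codeP; set s := undup _.
pose W := word_weight (fun _ => fun a => expR (log_letter false a)) K.
have W0 w : 0 <= W w by apply: word_weight_ge0 => t a; exact: expR_ge0.
have : \sum_(c <- s) \sum_(w | code w == c) W w <= 1.
  rewrite -(word_weight_sum1 (fun _ a => expR (log_letter false a)) K).
    rewrite (sum_over_values _ _ _ code xpredT) ?undup_uniq //.
    by rewrite big_mkcond; apply: ler_sum => w _; case: ifP.
  by move=> t; exact: log_letter_sum1.
have le1 : \sum_(c <- s) expR (- X) <= \sum_(c <- s) \sum_(w | code w == c) W w.
  rewrite big_seq [X in _ <= X]big_seq; apply: ler_sum => c.
  rewrite mem_undup => /mapP[w]; rewrite mem_filter => /andP[gw _] ->.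
  have : expR (- X) <= expR (\sum_(t < K) cyl_log (fun=> false) k l t (w t)).
    by rewrite ler_expR.
  move/le_trans; apply.
  rewrite -(cylinder_mass col al a0).
  rewrite [X in X <= _]big_mkcond [X in _ <= X]big_mkcond /=; apply: ler_sum => w' _.
  case: forallP => [/codeP ->|_]; first by rewrite eqxx.
  by case: ifP.
move=> /(le_trans le1); rewrite sum_const_seq expRN.
by rewrite ler_pdivrMr ?expR_gt0 // mul1r.
Qed.

End GoodScales.

(** * Digit expansions *)

Section Digits.
Context {R : realType}.
Implicit Types (d : nat -> nat).

Fixpoint numeral (b : nat) d (l : nat) : nat :=
  if l is l'.+1 then (b * numeral b d l' + d l')%N else 0%N.

Lemma numeral_inj b d d' l : (forall t, (d t < b)%N) -> (forall t, (d' t < b)%N) ->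
  numeral b d l = numeral b d' l -> forall t, (t < l)%N -> d t = d' t.
Proof.
move=> db d'b; elim: l => [//|l IH] /= e t.
have b0 : (0 < b)%N by apply: leq_trans (db 0%N).
have E : d l = d' l.
  have := congr1 (modn^~ b) e; rewrite !(mulnC b) !modnMDl.
  by rewrite !modn_small.
have E' : numeral b d l = numeral b d' l.
  by apply/eqP; rewrite -(eqn_pmul2l b0) -(eqn_add2r (d l)) {2}E e.
by rewrite ltnS leq_eqVlt => /orP[/eqP ->|/(IH E')].
Qed.

Lemma eq_numeral b d d' l : (forall t, (t < l)%N -> d t = d' t) ->
  numeral b d l = numeral b d' l.
Proof.
elim: l => [//|l IH] E /=; rewrite E // IH // => t tl.
by apply: E; rewrite ltnS ltnW.
Qed.

(** The point lies in the closed interval of length b^-l determined by its first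
[l] digits.  Closed intervals overlap at their endpoints, so a point may lie in
strips of two codes. *)
Definition in_strip (b : nat) d (l : nat) (x : R) : Prop :=
  (numeral b d l)%:R <= b%:R ^+ l * x <= (numeral b d l).+1%:R.

Lemma orbit_strip b d (z : nat -> R) l : (0 < b)%N ->
  (forall t, (t < l)%N -> z t = (z t.+1 + (d t)%:R) / b%:R) ->
  0 <= z l <= 1 -> in_strip b d l (z 0%N).
Proof.
move=> b0 zE zl.
have b1 : b%:R != 0 :> R by rewrite pnatr_eq0 -lt0n.
suff : b%:R ^+ l * z 0%N = (numeral b d l)%:R + z l.
  by rewrite /in_strip => ->; rewrite -natr1 lerDl lerD2l.
elim: l zE {zl} => [|l IH] zE; first by rewrite expr0 mul1r add0r.
have -> : b%:R ^+ l.+1 * z 0%N = b%:R * (b%:R ^+ l * z 0%N).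
  by rewrite exprS mulrA.
rewrite IH => [|t tl]; last by apply: zE; rewrite ltnS ltnW.
rewrite zE //= natrD natrM; field.
by [].
Qed.

(** Strips have integral endpoints after scaling by b^l, so points within one
strip width belong to strips whose numbers differ by at most 2. *)
Lemma strip_near b d d' l (x x' : R) :
  in_strip b d l x -> in_strip b d' l x' -> `|x - x'| * b%:R ^+ l <= 1 ->
  (numeral b d l <= numeral b d' l + 2)%N.
Proof.
move=> /andP[h1 _] /andP[_ h2] h3; rewrite -(ler_nat R) natrD.
have b0 : 0 <= b%:R ^+ l :> R by rewrite exprn_ge0.
have : (x - x') * b%:R ^+ l <= `|x - x'| * b%:R ^+ l.
  by rewrite ler_wpM2r // ler_norm.
move: h2; rewrite -natr1; nra.
Qed.

(** One backward step halves at least the distance to the unit interval, and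
this distance is bounded on [E]. *)
Lemma unit_attractor (b : nat) (E : set R) : (1 < b)%N -> bounded_set E ->
  (forall x, E x -> exists y (i : nat), [/\ E y, (i < b)%N & x = (y + i%:R) / b%:R]) ->
  forall x, E x -> 0 <= x <= 1.
Proof.
move=> b1 [M0 [_ bd]] step.
pose M := `|M0| + 1.
have M1 : 1 <= M by rewrite lerDr.
have EM x : E x -> - M <= x <= M.
  move=> /(bd M) h; rewrite -ler_norml; apply: h.
  by rewrite /M ltr_pwDr // ler_norm.
have b2 : 2 <= b%:R :> R by rewrite ler_nat.
have iter k : forall x, E x -> - (M / 2 ^+ k) <= x <= 1 + M / 2 ^+ k.
  elim: k => [|k IH] x Ex.
    by have := EM x Ex; rewrite expr0 divr1; lra.
  have [y [d [Ey db ->]]] := step x Ex.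
  have d1 : d%:R <= b%:R - 1 :> R by rewrite lerBrDr natr1 ler_nat.
  have d0 : 0 <= d%:R :> R by [].
  have := IH y Ey; rewrite exprS invfM mulrCA; set u := M / 2 ^+ k => /andP[h1 h2].
  have u0 : 0 <= u by rewrite divr_ge0 ?exprn_ge0 //; lra.
  have bp : 0 < b%:R :> R by lra.
  apply/andP; split.
    by rewrite ler_pdivlMr //; nra.
  by rewrite ler_pdivrMr //; nra.
have small (v : R) : (forall k, v <= M / 2 ^+ k) -> v <= 0.
  move=> h; rewrite leNgt; apply/negP => v0.
  pose k := (Num.truncn (M / v)).+1.
  have := h k; rewrite ler_pdivlMr ?exprn_gt0 // mulrC -ler_pdivlMr //.
  apply/negP; rewrite -ltNge.
  apply: lt_trans (truncnS_gt _) _; rewrite -/k -natrX ltr_nat.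
  exact: ltn_expl.
move=> x Ex; apply/andP; split.
  rewrite -oppr_le0; apply: small => k.
  by have /andP[h _] := iter k x Ex; rewrite lerNl.
rewrite -subr_le0; apply: small => k.
by have /andP[_ h] := iter k x Ex; rewrite lerBlDl.
Qed.

End Digits.

(** * Coding the carpet *)

Section CarpetCoding.
Context {R : realType} {m n : nat}.
Variables (A : {set 'I_m * 'I_n}) (L : set 'rV[R]_2).
Hypotheses (m2 : (2 <= m)%N) (mn : (m < n)%N) (carpetL : is_carpet A L).

Local Notation letter := {p : 'I_m * 'I_n | p \in A}.

Definition col_of (a : letter) : 'I_m := (val a).1.
Definition xdigit (w : nat -> letter) (t : nat) : nat := (val (w t)).1.
Definition ydigit (w : nat -> letter) (t : nat) : nat := (val (w t)).2.

(** The letters of the code are read as the digits of the abscissa in base m and of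
the ordinate in base n. *)
Definition coded (w : nat -> letter) (x : 'rV[R]_2) : Prop :=
  forall l, in_strip m (xdigit w) l (x 0 0) /\ in_strip n (ydigit w) l (x 0 1).

Let n2 : (2 <= n)%N. Proof. exact: leq_trans m2 (ltnW mn). Qed.

Lemma carpet_map_x (p : 'I_m * 'I_n) (x : 'rV[R]_2) :
  carpet_map p x 0 0 = (x 0 0 + (p.1 : nat)%:R) / m%:R.
Proof. by rewrite mxE. Qed.

Lemma carpet_map_y (p : 'I_m * 'I_n) (x : 'rV[R]_2) :
  carpet_map p x 0 1 = (x 0 1 + (p.2 : nat)%:R) / n%:R.
Proof. by rewrite mxE. Qed.

Lemma carpet_preimage x : L x -> exists (a : letter) y, L y /\ x = carpet_map (val a) y.
Proof.
case: carpetL => _ _ LE; rewrite {1}LE => -[p /= pA [y Ly <-]].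
by exists (exist _ p pA), y.
Qed.

Lemma carpet_image (a : letter) y : L y -> L (carpet_map (val a) y).
Proof.
case: carpetL => _ _ LE Ly; rewrite LE; exists (val a); first exact: (valP a).
by exists y.
Qed.

Lemma carpet_coord_bounded i : bounded_set ((fun x : 'rV[R]_2 => x 0 i) @` L).
Proof.
case: carpetL => _ cL _; apply: compact_bounded; apply: continuous_compact => //.
by apply: continuous_subspaceT => x; exact: coord_continuous.
Qed.

Lemma carpet_unit_square x : L x -> 0 <= x 0 0 <= 1 /\ 0 <= x 0 1 <= 1.
Proof.
move=> Lx; split.
  apply: (unit_attractor m _ m2 (carpet_coord_bounded 0)); last by exists x.
  move=> _ [y /carpet_preimage[a [z [Lz ->]]] <-].
  exists (z 0 0), (val a).1; split; [by exists z | exact: ltn_ord |].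
  exact: carpet_map_x.
apply: (unit_attractor n _ n2 (carpet_coord_bounded 1)); last by exists x.
move=> _ [y /carpet_preimage[a [z [Lz ->]]] <-].
exists (z 0 1), (val a).2; split; [by exists z | exact: ltn_ord |].
exact: carpet_map_y.
Qed.

Lemma orbit_in_strips w (z : nat -> 'rV[R]_2) l :
  (forall t, (t < l)%N -> z t = carpet_map (val (w t)) (z t.+1)) -> L (z l) ->
  in_strip m (xdigit w) l (z 0%N 0 0) /\ in_strip n (ydigit w) l (z 0%N 0 1).
Proof.
move=> zE /carpet_unit_square[zx zy]; split.
  apply: (orbit_strip _ _ (fun t => z t 0 0)); rewrite ?(ltn_trans _ m2) //.
  by move=> t tl; rewrite zE // carpet_map_x.
apply: (orbit_strip _ _ (fun t => z t 0 1)); rewrite ?(ltn_trans _ n2) //.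
by move=> t tl; rewrite zE // carpet_map_y.
Qed.

Lemma carpet_point_has_code x : L x -> exists w, coded w x.
Proof.
move=> Lx.
have step y : exists ay : letter * 'rV[R]_2,
    L y -> L ay.2 /\ y = carpet_map (val ay.1) ay.2.
  have [Ly|nLy] := pselect (L y).
    by have [a [z [Lz yE]]] := carpet_preimage y Ly; exists (a, z).
  by have [a [z _]] := carpet_preimage x Lx; exists (a, z).
have [g gP] := choice step.
pose z t := iter t (fun y => (g y).2) x.
have Lz t : L (z t) by elim: t => [//|t /gP[]].
exists (fun t => (g (z t)).1) => l; apply: (orbit_in_strips _ z) => // t _.
by have [] := gP _ (Lz t).
Qed.

Lemma closed_strip b d l (i : 'I_2) : closed [set x : 'rV[R]_2 | in_strip b d l (x 0 i)].
Proof.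
have cf : continuous (fun x : 'rV[R]_2 => b%:R ^+ l * x 0 i).
  move=> x; exact (@cvgMl_tmp R _ _ _ _ _ _ (@coord_continuous R 1 2 0 i x)).
have -> : [set x : 'rV[R]_2 | in_strip b d l (x 0 i)]
    = (fun x : 'rV[R]_2 => b%:R ^+ l * x 0 i) @^-1`
        `[(numeral b d l)%:R, (numeral b d l).+1%:R].
  by apply/seteqP; split => x /=; rewrite in_itv.
apply: preimage_closed; last exact: interval_closed.
by move=> x _; exact: cf.
Qed.

(** Finite compositions of the maps give points of the carpet in the first [N]
strips.  A cluster point of these lies in all the strips, which are closed. *)
Lemma code_has_carpet_point w : exists2 x, L x & coded w x.
Proof.
have [[x0 Lx0] cL _] := carpetL.
have fin N : forall v : nat -> letter, exists z : nat -> 'rV[R]_2,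
    (forall t, (t <= N)%N -> L (z t)) /\
    (forall t, (t < N)%N -> z t = carpet_map (val (v t)) (z t.+1)).
  elim: N => [|N IH] v; first by exists (fun=> x0).
  have [z [Lz zE]] := IH (fun t => v t.+1).
  exists (fun t => if t is t'.+1 then z t' else carpet_map (val (v 0%N)) (z 0%N)).
  split => -[|t] //; [by move=> _; apply/carpet_image/Lz | exact: Lz | exact: zE].
have approx N : exists x, L x /\ forall l, (l <= N)%N ->
    in_strip m (xdigit w) l (x 0 0) /\ in_strip n (ydigit w) l (x 0 1).
  have [z [Lz zE]] := fin N w.
  exists (z 0%N); split; first exact: Lz.
  move=> l lN; apply: orbit_in_strips; last exact: Lz.
  by move=> t tl; apply: zE; exact: leq_trans lN.
have [X XP] := choice approx.
have LX : (X @ \oo) L by exists 0%N => // N _; exact: (XP N).1.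
have [p [Lp clp]] := cL _ _ LX.
exists p => // l.
have near_strip (E : set 'rV[R]_2) : closed E ->
    (forall N, (l <= N)%N -> E (X N)) -> E p.
  move=> cE EX; rewrite (iffLR (closure_id E) cE).
  move: clp; rewrite clusterE; apply.
  by exists l => // N /= lN; exact: EX.
split; apply: (near_strip _ (closed_strip _ _ _ _)) => N lN;
  by have [] := (XP N).2 l lN.
Qed.

(** A diagonal argument in which the letters at positions K + 2i and K + 2i + 1
are chosen so as to avoid [c i].  Doubling the letter matters: strips of
adjacent columns touch, but after two equal letters from different columns there
is a gap, so that one of the two choices misses the given point. *)
Lemma code_avoiding_sequence (a b : letter) (K : nat) (w : nat -> letter)
    (c : nat -> 'rV[R]_2) : (col_of a < col_of b)%N ->
  exists w', (forall t, (t < K)%N -> w' t = w t) /\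
             (forall i, ~ coded w' (c i)).
Proof.
move=> ab.
pose da : nat := col_of a; pose db : nat := col_of b.
pose two (s d : nat) := (m * (m * s + d) + d)%N.
pose hit (i s : nat) := `[< (two s da)%:R <= (m%:R : R) ^+ (K + i.+1.*2) * (c i) 0 0
                         <= (two s da).+1%:R >].
(* the number of the strip that is reached after i such choices *)
pose st := fix st i := if i is i'.+1 then
    two (st i') (if hit i' (st i') then db else da) else numeral m (xdigit w) K.
pose w' t := if (t < K)%N then w t
  else let i := (t - K)./2 in if hit i (st i) then b else a.
have w'E i : w' (K + i.*2)%N = (if hit i (st i) then b else a) /\
             w' (K + i.*2).+1 = (if hit i (st i) then b else a).
  have h1 : ((K + i.*2 - K)./2 = i)%N by rewrite addKn doubleK.
  have h2 : (((K + i.*2).+1 - K)./2 = i)%N.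
    by rewrite -addnS addKn -[i.*2.+1]/(true + i.*2)%N half_bit_double.
  by split; rewrite /w' ltnNge ?(leqW (leq_addr _ _)) ?leq_addr /= ?h1 ?h2.
have stE i : numeral m (xdigit w') (K + i.*2) = st i.
  elim: i => [|i IH].
    by rewrite addn0 /=; apply: eq_numeral => t tK; rewrite /xdigit /w' tK.
  rewrite doubleS !addnS /= IH /xdigit; have [-> ->] := w'E i.
  by rewrite /two; case: ifP.
exists w'; split => [t tK|i /(_ (K + i.+1.*2)%N)[+ _]]; first by rewrite /w' tK.
rewrite /in_strip stE /= -/(st i); case: ifP => hi; last first.
  by move=> h; move/negP: hi; apply; apply/asboolP.
have /asboolP/andP[_ h1] := hi; move=> /andP[h2 _].
have : (two (st i) db <= (two (st i) da).+1)%N by rewrite -(ler_nat R) (le_trans h2 h1).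
have : (m * da + m <= m * db)%N by rewrite addnC -mulnS leq_mul2l ab orbT.
by rewrite /two !mulnDr; move: ab m2; rewrite -/da -/db; lia.
Qed.

End CarpetCoding.

(** * Diameters, words and levels *)

Local Notation edist := Defs.edist.

Section Diameters.
Context {R : realType}.
Implicit Types (x y : 'rV[R]_2) (U : set 'rV[R]_2).

Lemma coord_le_edist x y i : `|x 0 i - y 0 i| <= edist x y.
Proof.
rewrite /edist -sqrtr_sqr ler_sqrt; last by apply: sumr_ge0 => k _; exact: sqr_ge0.
by rewrite (bigD1 i) //= lerDl; apply: sumr_ge0 => k _; exact: sqr_ge0.
Qed.

Lemma edist_le_coords x y :
  edist x y <= `|x 0 0 - y 0 0| + `|x 0 1 - y 0 1|.
Proof.
rewrite /edist big_ord_recl big_ord1 /=.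
rewrite (_ : lift ord0 ord0 = 1); last exact: val_inj.
rewrite -[X in _ <= X]ger0_norm ?addr_ge0 // -sqrtr_sqr ler_sqrt ?sqr_ge0 //.
rewrite [X in _ <= X]sqrrD !real_normK ?num_real // lerD2r lerDl.
by rewrite mulrn_wge0 // mulr_ge0.
Qed.

Lemma edist_le_diam U x y : U x -> U y -> ((edist x y)%:E <= diam U)%E.
Proof.
move=> Ux Uy; apply: ereal_sup_ubound; right.
by exists (x, y).
Qed.

Lemma diam_ge0 U : (0 <= diam U)%E.
Proof. by apply: ereal_sup_ubound; left. Qed.

Lemma diam_le U (r : R) : 0 <= r ->
  (forall x y, U x -> U y -> edist x y <= r) -> (diam U <= r%:E)%E.
Proof.
move=> r0 Ur; apply: ge_ereal_sup => _ [->|[[x y] [/= Ux Uy] <-]].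
  by rewrite lee_fin.
by rewrite lee_fin Ur.
Qed.

Lemma diam0_eq U x y : diam U = 0%E -> U x -> U y -> x = y.
Proof.
move=> d0 Ux Uy; have := edist_le_diam _ _ _ Ux Uy; rewrite d0 lee_fin => e0.
apply/rowP => i; apply/eqP; rewrite -subr_eq0 -normr_le0.
exact: le_trans (coord_le_edist _ _ _) e0.
Qed.

Lemma poweR_diam_le U (r s : R) : 0 <= s -> (diam U <= r%:E)%E ->
  (poweR (diam U) s <= (r `^ s)%:E)%E.
Proof.
move=> s0 Ur; rewrite -poweR_EFin.
have r0 : (0 <= r%:E)%E := le_trans (diam_ge0 U) Ur.
by apply: gt0_ler_poweR => //; rewrite in_itv /= leey ?diam_ge0 ?r0.
Qed.

End Diameters.

Section Words.
Context {S : finType}.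
Variable a0 : S.

Definition extend K (w : {ffun 'I_K -> S}) (t : nat) : S :=
  if insub t is Some i then w i else a0.

Lemma extendE K (w : {ffun 'I_K -> S}) (t : 'I_K) : extend K w t = w t.
Proof. by rewrite /extend valK. Qed.

Definition truncate K (w : nat -> S) : {ffun 'I_K -> S} := [ffun t : 'I_K => w t].

Lemma extend_truncate K w t : (t < K)%N -> extend K (truncate K w) t = w t.
Proof. by move=> tK; rewrite -[t]/(val (Ordinal tK)) extendE ffunE. Qed.

End Words.

Section Levels.
Context {R : realType} {m n : nat}.
Hypotheses (m2 : (2 <= m)%N) (mn : (m < n)%N).

(** The exponent alpha: the widths m^-l and heights n^-k agree for
l = k / alpha. *)
Definition ratio : R := ln m%:R / ln n%:R.
Definition col_level (k : nat) : nat := trunc_log m (n ^ k).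

Lemma ln_m_gt0 : 0 < ln m%:R :> R.
Proof. by rewrite ln_gt0 // ltr1n. Qed.

Lemma ln_m_lt_n : ln m%:R < ln n%:R :> R.
Proof. by rewrite ltr_ln ?posrE ?ltr_nat ?ltr0n //; lia. Qed.

Lemma ln_n_gt0 : 0 < ln n%:R :> R.
Proof. exact: lt_trans ln_m_gt0 ln_m_lt_n. Qed.

Lemma ratio01 : 0 < ratio < 1.
Proof.
by rewrite divr_gt0 ?ln_m_gt0 ?ln_n_gt0 //= ltr_pdivrMr ?ln_n_gt0 // mul1r ln_m_lt_n.
Qed.

Lemma col_level_bounds k : (m ^ col_level k <= n ^ k < m ^ (col_level k).+1)%N.
Proof. by apply: trunc_log_bounds => //; rewrite expn_gt0; lia. Qed.

Lemma ln_expn (b k : nat) : (0 < b)%N -> ln (b ^ k)%:R = k%:R * ln b%:R :> R.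
Proof. by move=> b0; rewrite natrX lnXn ?ltr0n // mulr_natl. Qed.

Lemma col_levelP k : level_pair ratio k (col_level k).
Proof.
have /andP[h1 h2] := col_level_bounds k.
have m0 : (0 < m)%N by lia.
have n0 : (0 < n)%N by lia.
apply/andP; rewrite /ratio mulrAC ler_pdivrMr ?ln_n_gt0 //.
rewrite mulrAC ltr_pdivlMr ?ln_n_gt0 //.
rewrite ![ln m%:R * _]mulrC -!ln_expn //; split.
  by rewrite ler_ln ?posrE ?ltr0n ?expn_gt0 ?m0 ?n0 // ler_nat.
by rewrite ltr_ln ?posrE ?ltr0n ?expn_gt0 ?m0 ?n0 // ltr_nat.
Qed.

Lemma scale_of_diameter (d : R) : 0 < d <= 1 ->
  exists k : nat, - (k.+1)%:R * ln n%:R < ln d <= - k%:R * ln n%:R.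
Proof.
move=> /andP[d0 d1]; have l0 := ln_n_gt0; have ld0 : ln d <= 0 by exact: ln_le0.
exists (Num.truncn (- ln d / ln n%:R)).
have x0 : 0 <= - ln d / ln n%:R by rewrite divr_ge0 ?oppr_ge0 // ltW.
have /andP[h1 h2] := truncn_itv x0.
move: h1 h2; rewrite ler_pdivlMr // ltr_pdivrMr // => h1 h2.
by apply/andP; split; lra.
Qed.

(** Bounds the finest level used by the covers, hence their smallest
diameter. *)
Lemma iter_col_level_growth k j : (iter j col_level k)%:R <= ratio ^- j * k%:R :> R.
Proof.
have [r0 _] := andP ratio01.
elim: j => [|j IH]; first by rewrite expr0 invr1 mul1r.
have /andP[h _] := col_levelP (iter j col_level k).
rewrite iterS exprS invfM -mulrA ler_pdivlMl //.
exact: le_trans h IH.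
Qed.

Lemma iter_col_level_ge k j : (k <= iter j col_level k)%N.
Proof.
elim: j => [//|j IH]; apply: leq_trans IH _; rewrite iterS.
exact: level_pair_le ratio01 _ _ (col_levelP _).
Qed.

End Levels.

(** * Upper bound for the intermediate dimensions *)

Section UpperBound.
Context {R : realType} {m n : nat}.
Variables (A : {set 'I_m * 'I_n}) (L : set 'rV[R]_2).
Hypotheses (m2 : (2 <= m)%N) (mn : (m < n)%N) (carpetL : is_carpet A L).

Local Notation letter := {p : 'I_m * 'I_n | p \in A}.
Variable a0 : letter.

Local Notation al := (@ratio R m n).
Local Notation col_level := (@col_level m n).
Local Notation col := (@col_of m n A).
Local Notation ln_partition := (ln_partition col al).

Definition box (k : nat) (cd : nat * nat) : set 'rV[R]_2 :=
  [set x | cd.1%:R <= m%:R ^+ col_level k * x 0 0 <= cd.1.+1%:R /\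
           cd.2%:R <= n%:R ^+ k * x 0 1 <= cd.2.+1%:R].

Definition box_code (k : nat) (w : nat -> letter) : nat * nat :=
  (numeral m (xdigit A w) (col_level k), numeral n (ydigit A w) k).

Let m0 : (0 < m)%N. Proof. exact: leq_trans m2. Qed.
Let n0 : (0 < n)%N. Proof. exact: leq_trans m0 (ltnW mn). Qed.

Lemma eq_box_code k (w w' : nat -> letter) :
  (forall t, (t < col_level k)%N -> same_cyl col k (col_level k) t (w t) (w' t)) ->
  box_code k w = box_code k w'.
Proof.
move=> ww'; have klv := level_pair_le al (ratio01 m2 mn) _ _ (col_levelP m2 mn k).
congr pair; apply: eq_numeral => t tk.
  have := ww' t tk; rewrite /same_cyl tk /xdigit; case: ifP => _ /eqP; first by move=> ->.
  by rewrite /col_of => ->.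
have := ww' t (leq_trans tk klv).
by rewrite /same_cyl tk /ydigit => /eqP ->.
Qed.

Lemma box_diam_le k cd :
  (diam (box k cd) <= (m.+1%:R * expR (- k%:R * ln n%:R))%:E)%E.
Proof.
have mp : 0 < m%:R :> R by rewrite ltr0n.
have np : 0 < n%:R :> R by rewrite ltr0n.
have nE : expR (- k%:R * ln n%:R) = (n%:R ^+ k)^-1 :> R.
  by rewrite mulNr expRN expRM_natl lnK.
rewrite nE; apply: diam_le; first by rewrite mulr_ge0 // invr_ge0 exprn_ge0.
move=> x y [/= x1 x2] [/= y1 y2]; apply: le_trans (edist_le_coords _ _) _.
rewrite -natr1 mulrDl mul1r lerD //.
  apply: (le_trans (y := (m%:R ^+ col_level k)^-1)).
    rewrite -[X in _ <= X]mul1r ler_pdivlMr ?exprn_gt0 //.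
    rewrite -[X in _ * X](ger0_norm (exprn_ge0 _ (ltW mp))) -normrM ler_norml.
    move: x1 y1; rewrite -natr1 mulrBl ![_ * m%:R ^+ _]mulrC => /andP[? ?] /andP[? ?].
    by apply/andP; split; lra.
  rewrite ler_pdivlMr ?exprn_gt0 // mulrC ler_pdivrMr ?exprn_gt0 //.
  rewrite -exprS -!natrX ler_nat ltnW //.
  by case/andP: (col_level_bounds m2 mn k).
rewrite -[X in _ <= X]mul1r ler_pdivlMr ?exprn_gt0 //.
rewrite -[X in _ * X](ger0_norm (exprn_ge0 _ (ltW np))) -normrM ler_norml.
move: x2 y2; rewrite -natr1 mulrBl ![_ * n%:R ^+ _]mulrC => /andP[? ?] /andP[? ?].
by apply/andP; split; lra.
Qed.

Lemma box_diam_ge k cd : ((expR (- k%:R * ln n%:R))%:E <= diam (box k cd))%E.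
Proof.
have mp : 0 < m%:R :> R by rewrite ltr0n.
have np : 0 < n%:R :> R by rewrite ltr0n.
have nE : expR (- k%:R * ln n%:R) = (n%:R ^+ k)^-1 :> R.
  by rewrite mulNr expRN expRM_natl lnK.
have mk : m%:R ^+ col_level k != 0 :> R by rewrite gt_eqF // exprn_gt0.
have nk : n%:R ^+ k != 0 :> R by rewrite gt_eqF // exprn_gt0.
pose corner (e : R) : 'rV[R]_2 :=
  \row_i (if i == 0 then cd.1%:R / m%:R ^+ col_level k else (cd.2%:R + e) / n%:R ^+ k).
have cornerP e : 0 <= e <= 1 -> box k cd (corner e).
  move=> /andP[e0 e1]; split => /=; rewrite mxE /= mulrC divfK //.
    by rewrite lexx ler_nat leqnSn.
  by rewrite -natr1 lerD2l e1 lerDl e0.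
have b1 : box k cd (corner 1) by apply: cornerP; rewrite ler01 lexx.
have b0 : box k cd (corner 0) by apply: cornerP; rewrite ler01 lexx.
apply: le_trans (edist_le_diam _ _ _ b1 b0); rewrite lee_fin nE.
apply: le_trans _ (coord_le_edist _ _ 1); rewrite !mxE /= -mulrBl.
by rewrite addr0 (addrC _ 1) addrK mul1r ler_norm.
Qed.

(** Boxes of level [k] are indexed by their integral coordinates; those kept have
McMullen mass at least exp(- (h ln n + eta) k). *)
Definition good_codes (eta : R) (k : nat) : seq (nat * nat) :=
  undup [seq box_code k (extend a0 (col_level k) w) | w : {ffun 'I_(col_level k) -> letter}
           <- enum {: {ffun 'I_(col_level k) -> letter}} &
         - ((ln_partition / al + eta) * k%:R)
           <= \sum_(t < col_level k) cyl_log col al (fun=> false) k (col_level k) t (w t)].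

Lemma size_good_codes eta k :
  (size (good_codes eta k))%:R <= expR ((ln_partition / al + eta) * k%:R).
Proof.
apply: (count_codes col al a0 _ _ k (col_level k)) => w w' ww'; apply: eq_box_code => t tk.
by rewrite -[t]/(val (Ordinal tk)) !extendE; exact: ww'.
Qed.

Definition boxes eta (k0 J : nat) : seq (nat * (nat * nat)) :=
  flatten [seq [seq (iter j col_level k0, cd) | cd <- good_codes eta (iter j col_level k0)]
          | j <- iota 0 J].

(** The level at which a point is covered depends on the point, but is one of the
first [J] iterates. *)
Lemma boxes_cover eta k0 J x : 0 < eta -> 2 * ln #|{: letter}|%:R < J%:R * eta ->
  (2 * J <= k0)%N -> L x -> exists2 r, r \in boxes eta k0 J & box r.1 r.2 x.
Proof.
move=> eta0 hJ hk0 Lx.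
have [w wx] := carpet_point_has_code A L m2 mn carpetL x Lx.
have [j jJ good] := exists_good_scale col al a0 (ratio01 m2 mn) eta J
  (fun j => iter j col_level k0) w eta0 hJ hk0 (fun j => col_levelP m2 mn _).
pose k := iter j col_level k0; exists (k, box_code k w); last first.
  by split; [exact: (wx (col_level k)).1 | exact: (wx k).2].
apply/flattenP; exists [seq (k, cd) | cd <- good_codes eta k].
  by apply/mapP; exists j => //; rewrite mem_iota.
apply/mapP; exists (box_code k w) => //.
rewrite mem_undup; apply/mapP; exists (truncate (col_level k) w).
  rewrite mem_filter mem_enum andbT -mulNr; apply: (le_trans good).
  rewrite /mcmullen_log big_mkord le_eqVlt; apply/orP; left; apply/eqP.
  by apply: eq_bigr => t _; rewrite ffunE.
apply: eq_box_code => t tk; rewrite extend_truncate //.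
by rewrite /same_cyl; case: ifP => //; case: ifP.
Qed.

Lemma cost_boxes_le (rs : seq (nat * (nat * nat))) (s : R) r0 : 0 <= s ->
  (cost `I_(size rs) (fun i => box (nth r0 rs i).1 (nth r0 rs i).2) s
   <= (\sum_(r <- rs) (m.+1%:R * expR (- r.1%:R * ln n%:R)) `^ s)%:E)%E.
Proof.
move=> s0; rewrite /cost esum_fset ?finite_II //; last first.
  by move=> i _; exact: poweR_ge0.
rewrite -(fsbig_ord _ _ (fun i => poweR (diam (box (nth r0 rs i).1 (nth r0 rs i).2)) s)).
rewrite (big_nth r0) big_mkord -sumEFin; apply: lee_sum => i _.
by apply: poweR_diam_le => //; exact: box_diam_le.
Qed.

(** The boxes at a level [k] number at most exp((h ln n + e) k), with e half of
eta ln n, and each contributes at most a constant times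
exp(- (h ln n + 2 e) k), so every level costs at most a constant times
exp(- e k0).  The J levels lie between k0 and al^-J k0, which is why theta has to
be less than al^J / 2; the factor 2 absorbs the constants relating k0 to
delta. *)
Lemma upper_dim_le (eta : R) : 0 < eta -> exists2 theta0 : R, 0 < theta0 &
  forall theta, 0 < theta < theta0 ->
    upper_intermediate_dim theta L <= ln_partition / ln m%:R + eta.
Proof.
move=> eta0; have lm0 := @ln_m_gt0 R m m2; have ln0 := @ln_n_gt0 R m n m2 mn.
have [al0 al1] := andP (@ratio01 R m n m2 mn).
pose e := eta * ln n%:R / 2.
have e0 : 0 < e by rewrite divr_gt0 ?mulr_gt0.
pose J := (Num.truncn (2 * ln #|{: letter}|%:R / e : R)).+1.
have hJ : 2 * ln #|{: letter}|%:R < J%:R * e.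
  by rewrite -ltr_pdivrMr // truncnS_gt.
pose g := al ^- J; have g0 : 0 < g by rewrite invr_gt0 exprn_gt0.
exists (2 * g)^-1; first by rewrite invr_gt0 mulr_gt0.
move=> theta /andP[th0 th1].
have thg : 2 * g <= theta^-1.
  by rewrite -[X in X <= _]invrK lef_pV2 ?posrE ?invr_gt0 ?mulr_gt0 // ltW.
set s := ln_partition / ln m%:R + eta.
have s0 : 0 <= s.
  by rewrite addr_ge0 ?(ltW eta0) // divr_ge0 ?(ltW lm0) // (ln_partition_ge0 _ _ a0) ?ratio01.
apply: ge_inf; first by exists 0 => t [].
split => // eps eps0.
pose c := m.+1%:R `^ s : R.
have c0 : 0 < c by rewrite powR_gt0.
pose N := (2 * J)%:R + (J%:R * c) / (eps * e).
have N0 : 0 <= (J%:R * c) / (eps * e).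
  by rewrite divr_ge0 // mulr_ge0 // ltW.
pose b := ln (n * m.+1)%:R : R.
have b0 : 0 <= b by rewrite ln_ge0 // ler1n muln_gt0 n0.
(* N makes the cost small, and b accounts for the factors n and m + 1 that are
   lost between delta and the heights of the boxes of level k0 *)
pose Y := N * ln n%:R + b.
exists (expR (- Y)); first exact: expR_gt0.
move=> delta /andP[d0 dY].
have ldY : ln delta <= - Y by rewrite -[X in _ <= X]expRK ler_ln ?posrE ?expR_gt0.
have Y0 : b <= Y by rewrite lerDr mulr_ge0 ?(ltW ln0) // addr_ge0.
have lM : ln m.+1%:R <= b :> R.
  rewrite /b ler_ln ?posrE ?ltr0n ?muln_gt0 ?n0 // ler_nat.
  by rewrite leq_pmull.
have bE : b = ln n%:R + ln m.+1%:R.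
  by rewrite /b natrM lnM // posrE ltr0n.
have lM0 : 0 <= ln m.+1%:R :> R by rewrite ln_ge0 // ler1n.
have dp0 : 0 < delta / m.+1%:R by rewrite divr_gt0.
have ldE : ln (delta / m.+1%:R) = ln delta - ln m.+1%:R.
  by rewrite ln_div // posrE.
have d1 : delta / m.+1%:R <= 1.
  rewrite -ler_ln ?posrE // ln1 ldE; lra.
have [k' /andP[k1 k2]] := scale_of_diameter m2 mn _ (introT andP (conj dp0 d1)).
pose k0 := k'.+1.
have k0N : N <= k0%:R.
  rewrite -(ler_pM2r ln0).
  have k1' : - k0%:R * ln n%:R < ln delta - ln m.+1%:R by rewrite -ldE.
  by move: ldY k1'; rewrite /Y; clearbody N k0 b; lra.
have k0d : k0%:R * ln n%:R <= - 2 * ln delta.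
  have -> : k0%:R = k'%:R + 1 :> R by rewrite natr1.
  by move: k2; rewrite ldE; lra.
have Jk0 : (2 * J <= k0)%N by rewrite -(ler_nat R); apply: le_trans k0N; rewrite lerDl.
pose rs := boxes e k0 J.
exists `I_(size rs), (fun i => box (nth (0, (0, 0)) rs i).1 (nth (0, (0, 0)) rs i).2)%N.
have rsP r : r \in rs -> exists2 j, (j < J)%N & r.1 = iter j col_level k0.
  move=> /flattenP[_ /mapP[j + ->]] /mapP[cd _ ->].
  by rewrite mem_iota => /andP[_ jJ]; exists j.
split.
- move=> x Lx; have [r rrs rx] := boxes_cover e k0 J x e0 hJ Jk0 Lx.
  by exists (index r rs); rewrite /= ?index_mem ?nth_index.
- move=> i /= irs; have [j jJ ->] := rsP _ (mem_nth (0, (0, 0))%N irs).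
  apply/andP; split.
    apply: le_trans (box_diam_ge _ _); rewrite lee_fin.
    rewrite /powR gt_eqF // ler_expR.
    have h1 := @iter_col_level_growth R m n m2 mn k0 j.
    have h2 : al ^- j <= g.
      by rewrite /g lef_pV2 ?posrE ?exprn_gt0 // ler_wiXn2l ?(ltW al0) ?(ltW al1) // ltnW.
    have h3 : (iter j col_level k0)%:R * ln n%:R <= g * (k0%:R * ln n%:R).
      rewrite mulrA; apply: (ler_wpM2r (ltW ln0)); apply: le_trans h1 _.
      by rewrite ler_wpM2r.
    have h4 : g * (k0%:R * ln n%:R) <= g * (- 2 * ln delta).
      by rewrite ler_wpM2l // ltW.
    have h5 : 2 * g * - ln delta <= theta^-1 * - ln delta.
      by rewrite ler_wpM2r //; lra.
    lra.
  apply: le_trans (box_diam_le _ _) _; rewrite lee_fin.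
  rewrite mulrC -ler_pdivlMr // -[X in _ <= X]lnK ?posrE // ler_expR.
  apply: le_trans (ltW k1); rewrite !mulNr lerN2 ler_wpM2r ?(ltW ln0) //.
  by rewrite ler_nat iter_col_level_ge.
- apply: le_trans (cost_boxes_le _ _ _ s0) _; rewrite lee_fin.
  rewrite /rs /boxes big_flatten big_map.
  apply: (le_trans (y := \sum_(j <- iota 0 J) c * expR (- e * k0%:R))).
    apply: ler_sum => j _; rewrite big_map /=; set k := iter j col_level k0.
    rewrite sum_const_seq.
    rewrite powRM ?expR_ge0 // -/c mulrCA ler_wpM2l ?(ltW c0) //.
    have -> : expR (- k%:R * ln n%:R) `^ s = expR (- (ln_partition / al + 2 * e) * k%:R).
      rewrite /powR gt_eqF ?expR_gt0 // expRK; congr expR.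
      by rewrite /s /e /ratio; field; rewrite !gt_eqF.
    apply: (le_trans (ler_wpM2r (expR_ge0 _) (size_good_codes e k))).
    rewrite -expRD ler_expR.
    have : e * k0%:R <= e * k%:R by rewrite ler_wpM2l ?(ltW e0) // ler_nat iter_col_level_ge.
    lra.
  rewrite sum_const_seq size_iota.
  have ek : J%:R * c <= eps * (e * k0%:R).
    rewrite mulrA -ler_pdivrMl ?mulr_gt0 // mulrC; apply: le_trans k0N.
    by rewrite lerDr.
  rewrite mulrA mulNr expRN ler_pdivrMr ?expR_gt0 //; apply: (le_trans ek).
  rewrite ler_wpM2l ?(ltW eps0) //.
  by have := expR_ge1Dx (e * k0%:R); lra.
Qed.

End UpperBound.

(** * Lower bound for covers with two scales *)

Lemma window_inj (u v c : nat) : (u <= c + 2)%N -> (c <= u + 2)%N ->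
  (v <= c + 2)%N -> (c <= v + 2)%N ->
  inord (u + 2 - c) = inord (v + 2 - c) :> 'I_5 -> u = v.
Proof. by move=> h1 h2 h3 h4 /(congr1 val); rewrite /= !inordK; lia. Qed.

(** Compares the exponent [h + 2 eta] for masses with the exponent [h + eta] for
costs: the remaining factor d^eta beats all constants when [d] is small.  Here
50 is twice the bound 25 on the number of squares met, and the factor 2
compensates for the codes that were discarded. *)
Lemma power_ge_cylinder_mass {R : realType} (l h eta s d : R) (k : nat) :
  0 <= h -> 0 < eta -> s <= h + eta -> 0 < d -> ln d <= 0 ->
  ln 50 + (h + 2 * eta) * l <= eta * - ln d -> - k.+1%:R * l < ln d ->
  50 * expR (- ((h + 2 * eta) * l) * k%:R) <= d `^ s.
Proof.
move=> h0 eta0 sh d0 ld small dk.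
rewrite /powR gt_eqF // -[X in X * _](@lnK R) ?posrE // -expRD ler_expR.
have e1 : (h + eta) * ln d <= s * ln d by rewrite ler_wnM2r.
have e2 : (h + 2 * eta) * (- k.+1%:R * l) <= (h + 2 * eta) * ln d.
  by apply: ler_wpM2l (ltW dk); rewrite addr_ge0 // mulr_ge0 // ltW.
move: e2; rewrite -[k.+1]addn1 natrD; lra.
Qed.

Section LowerBound.
Context {R : realType} {m n : nat}.
Variables (A : {set 'I_m * 'I_n}) (L : set 'rV[R]_2).
Hypotheses (m2 : (2 <= m)%N) (mn : (m < n)%N) (carpetL : is_carpet A L).

Local Notation letter := {p : 'I_m * 'I_n | p \in A}.
Local Notation al := (@ratio R m n).
Local Notation col_level := (@col_level m n).
Local Notation col := (@col_of m n A).
Local Notation ln_partition := (ln_partition col al).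
Local Notation ln_fibre := (@ln_fibre R letter _ col).

Lemma card_column (i : 'I_m) : #|[pred b : letter | col b == i]| = column_size A i.
Proof.
rewrite /column_size.
have -> : [set j | (i, j) \in A]%SET
    = [set (val b).2 | b in [pred b : letter | col b == i]]%SET.
  apply/setP => j; rewrite inE; apply/idP/imsetP => [ijA|[b]].
    by exists (exist _ (i, j) ijA); rewrite ?inE.
  by rewrite inE => /eqP <- ->; rewrite -surjective_pairing; exact: (valP b).
rewrite card_in_imset // => b c; rewrite !inE => /eqP bi /eqP ci bc.
by apply: val_inj; apply: injective_projections => //; move: bi ci; rewrite /col_of => -> ->.
Qed.

(** Letters with different fibre sizes lie in different columns, so exchanging them
if necessary gives the order. *)
Lemma non_uniform_letters : non_uniform_fibres A ->
  exists a b : letter, ln_fibre a != ln_fibre b /\ (col a < col b)%N.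
Proof.
move=> nu; suff [a [b ab]] : exists a b : letter, ln_fibre a != ln_fibre b.
  case: (ltngtP (col a) (col b)) => h; first by exists a, b.
    by exists b, a; rewrite eq_sym.
  by move: ab; rewrite (ln_fibre_col col a b) ?eqxx //; exact: val_inj.
apply: contrapT => nex; apply: nu => i i'.
rewrite !inE -!card_column => /card_gt0P[a]; rewrite inE => /eqP <-.
move=> /card_gt0P[b]; rewrite inE => /eqP <-.
have : ln_fibre a = ln_fibre b.
  by apply/eqP; apply: contrapT => /negP ab; apply: nex; exists a, b.
move=> /(congr1 expR); rewrite !expR_ln_fibre => /eqP; rewrite eqr_nat => /eqP.
by [].
Qed.

(** The digits are determined by the integral coordinates, so distinct squares
have distinct boxes. *)
Lemma box_code_inj k (w w' : nat -> letter) : box_code A k w = box_code A k w' ->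
  forall t, same_cyl col k (col_level k) t (w t) (w' t).
Proof.
move=> [ex ey] t; have klv := level_pair_le al (ratio01 m2 mn) _ _ (col_levelP m2 mn k).
have xE s : (s < col_level k)%N -> (val (w s)).1 = (val (w' s)).1.
  move=> sk; apply: val_inj; apply: (numeral_inj m _ _ (col_level k) _ _ ex) => // u;
    exact: ltn_ord.
have yE s : (s < k)%N -> (val (w s)).2 = (val (w' s)).2.
  move=> sk; apply: val_inj; apply: (numeral_inj n _ _ k _ _ ey) => // u; exact: ltn_ord.
rewrite /same_cyl; case: ifP => tk.
  apply/eqP; apply: val_inj; apply: injective_projections.
    exact: xE (leq_trans tk klv).
  exact: yE.
by case: ifP => // tl; apply/eqP; exact: xE.
Qed.

Lemma sum_le_card_values (T Q : finType) (q : T -> Q) (P : pred T) (W : T -> R) (e : R) :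
  0 <= e -> (forall w1, P w1 -> \sum_(w | P w && (q w == q w1)) W w <= e) ->
  \sum_(w | P w) W w <= #|Q|%:R * e.
Proof.
move=> e0 H; rewrite (partition_big q xpredT) //= mulr_natl -sumr_const.
apply: ler_sum => j _.
have [/existsP[w1 /andP[Pw1 /eqP <-]]|/existsPn none] :=
  boolP [exists w, P w && (q w == j)]; first exact: H.
by rewrite big_pred0 // => w; apply/negbTE/none.
Qed.

(** The mass distribution estimate for one set [U] of the cover.  A word [w] is
represented by the point [X w], whose full code [V w] extends [w]; the words
counted by [P] have their point in [U], and therefore box coordinates in a
window of size 5 by 5. *)
Lemma few_cylinders_meet K k (d : R) (U : set 'rV[R]_2) (e : R)
    (V : {ffun 'I_K -> letter} -> nat -> letter) (X : {ffun 'I_K -> letter} -> 'rV[R]_2)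
    (P : pred {ffun 'I_K -> letter}) (W : {ffun 'I_K -> letter} -> R) :
  (forall w (t : 'I_K), V w t = w t) -> (forall w, coded A (V w) (X w)) ->
  diam U = d%:E -> 0 < d -> ln d <= - k%:R * ln n%:R ->
  (forall w, P w -> U (X w)) -> 0 <= e -> (forall w, 0 <= W w) ->
  (forall w, P w -> \sum_(w' : {ffun 'I_K -> letter}
     | [forall t : 'I_K, same_cyl col k (col_level k) t (w t) (w' t)]) W w' <= e) ->
  \sum_(w | P w) W w <= 25 * e.
Proof.
move=> VE VX dU d0 dk UX e0 W0 We.
have [/existsP[w0 Pw0]|/existsPn none] := boolP [exists w, P w]; last first.
  rewrite big_pred0 => [|w]; last by apply/negbTE/none.
  by rewrite mulr_ge0.
have mp : 0 < m%:R :> R by rewrite ltr0n; lia.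
have np : 0 < n%:R :> R by rewrite ltr0n; lia.
have dn : d * n%:R ^+ k <= 1.
  rewrite -ler_ln ?posrE ?mulr_gt0 ?exprn_gt0 // ln1 lnM ?posrE ?exprn_gt0 //.
  by rewrite lnXn // -[ln _ *+ k]mulr_natl; lra.
have dm : d * m%:R ^+ col_level k <= 1.
  apply: le_trans dn; rewrite ler_wpM2l ?(ltW d0) // -!natrX ler_nat.
  by case/andP: (col_level_bounds m2 mn k).
have near w w' i : P w -> P w' -> `|X w 0 i - X w' 0 i| <= d.
  move=> Pw Pw'; apply: le_trans (coord_le_edist _ _ _) _.
  by rewrite -lee_fin -dU; apply: edist_le_diam; exact: UX.
pose cx w := numeral m (xdigit A (V w)) (col_level k).
pose cy w := numeral n (ydigit A (V w)) k.
have nearx w w' : P w -> P w' -> (cx w <= cx w' + 2)%N.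
  move=> Pw Pw'; apply: strip_near (VX w (col_level k)).1 (VX w' (col_level k)).1 _.
  apply: le_trans dm; rewrite ler_wpM2r ?exprn_ge0 ?(ltW mp) //; exact: near.
have neary w w' : P w -> P w' -> (cy w <= cy w' + 2)%N.
  move=> Pw Pw'; apply: strip_near (VX w k).2 (VX w' k).2 _.
  apply: le_trans dn; rewrite ler_wpM2r ?exprn_ge0 ?(ltW np) //; exact: near.
(* relative to the box of w0, both coordinates of a box met by U vary in a
   window of five consecutive integers *)
pose q w : 'I_5 * 'I_5 := (inord (cx w + 2 - cx w0), inord (cy w + 2 - cy w0)).
have -> : 25 = #|{: 'I_5 * 'I_5}|%:R :> R by rewrite card_prod !card_ord.
apply: (sum_le_card_values _ _ q) => // w1 Pw1.
apply: le_trans (We w1 Pw1).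
rewrite [X in X <= _]big_mkcond [X in _ <= X]big_mkcond /=; apply: ler_sum => w _.
case: ifP => [/andP[Pw /eqP[qx qy]]|_]; last by case: ifP.
have code_eq : box_code A k (V w1) = box_code A k (V w).
  congr pair.
    by apply/esym/window_inj; [exact: (nearx w w0) | exact: (nearx w0 w)
      | exact: (nearx w1 w0) | exact: (nearx w0 w1) | exact: qx].
  by apply/esym/window_inj; [exact: (neary w w0) | exact: (neary w0 w)
    | exact: (neary w1 w0) | exact: (neary w0 w1) | exact: qy].
case: forallP => // -[] t; have := box_code_inj _ _ _ code_eq t.
by rewrite !VE.
Qed.

Lemma cost_ge_sum (I : set nat) (U : nat -> set 'rV[R]_2) (s : R) (J : seq nat) :
  uniq J -> (forall i, i \in J -> I i) ->
  (\sum_(i <- J) poweR (diam (U i)) s <= cost I U s)%E.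
Proof.
move=> uJ JI; apply: esum_ge; exists [set` J]; first by split; [exact: finite_seq | move=> i /= /JI].
by rewrite fsbig_seq.
Qed.

(** The two prescribed diameters may be negative, zero, equal or in any order.
Normalizing them leaves two positive scales and the sets of diameter 0. *)
Lemma positive_scales (I : set nat) (U : nat -> set 'rV[R]_2) (a b delta0 : R) :
  0 < delta0 -> at_most_two_scales I U a b -> a < delta0 -> b < delta0 ->
  exists lo hi : R, [/\ 0 < lo, lo <= hi, hi < delta0 &
    forall i, I i -> [\/ diam (U i) = 0%E, diam (U i) = lo%:E | diam (U i) = hi%:E]].
Proof.
move=> d0 two ad bd.
have nonpos i c : c <= 0 -> diam (U i) = c%:E -> diam (U i) = 0%E.
  move=> c0 dE; apply/eqP; rewrite eq_le diam_ge0 andbT dE lee_fin //.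
have [a0|a0] := lerP a 0; have [b0|b0] := lerP b 0.
- exists (delta0 / 2), (delta0 / 2); split => //; [lra | lra |].
  by move=> i /two[/nonpos ->|/nonpos ->] //; constructor 1.
- exists b, b; split => //; move=> i /two[/nonpos ->|->] //; [by constructor 1|].
  by constructor 2.
- exists a, a; split => //; move=> i /two[->|/nonpos ->] //; [|by constructor 1].
  by constructor 2.
- have [ab|ab] := lerP a b.
    by exists a, b; split => // i /two[->|->]; [constructor 2 | constructor 3].
  exists b, a; split => //; first exact: ltW.
  by move=> i /two[->|->]; [constructor 3 | constructor 2].
Qed.

(** Mass distribution principle.  Every word of length K is assigned a set of the
cover of positive diameter that contains a point coded by an extension of the
word; the good words carry mass at least 1/2, and the mass assigned to a set is
at most half of its contribution to the cost. *)
Lemma two_scale_cost (a b : letter) : ln_fibre a != ln_fibre b -> (col a < col b)%N ->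
  exists eta delta0 : R, [/\ 0 < eta, 0 < delta0 &
    forall (I : set nat) (U : nat -> set 'rV[R]_2) (r1 r2 s : R),
      covers L I U -> at_most_two_scales I U r1 r2 -> r1 < delta0 -> r2 < delta0 ->
      s <= ln_partition / ln m%:R + eta -> (1 <= cost I U s)%E].
Proof.
move=> fab cab; have lm0 := @ln_m_gt0 R m m2; have ln0 := @ln_n_gt0 R m n m2 mn.
have al01 := @ratio01 R m n m2 mn.
have [ka ka0 [ks measure]] := two_scale_measure col al a al01 a b fab.
pose eta := ka / ln n%:R; have eta0 : 0 < eta by rewrite divr_gt0.
have Z0 : 0 <= ln_partition by exact: ln_partition_ge0.
pose h := ln_partition / ln m%:R; have h0 : 0 <= h by rewrite divr_ge0 // ltW.
pose h' := h + 2 * eta; have h'0 : 0 <= h' by rewrite addr_ge0 // mulr_ge0 // ltW.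
have h'E : ln_partition / al + 2 * ka = h' * ln n%:R.
  by rewrite /h' /h /eta /ratio; field; rewrite !gt_eqF.
pose Y := ks%:R * ln n%:R + (ln 50 + h' * ln n%:R) / eta.
have l50 : 0 <= ln 50 :> R by rewrite ln_ge0 // ler1n.
have Y1 : ks%:R * ln n%:R <= Y.
  by rewrite lerDl divr_ge0 ?(ltW eta0) // addr_ge0 // mulr_ge0 // ltW.
have Y2 : ln 50 + h' * ln n%:R <= eta * Y.
  by rewrite (mulrC eta) -ler_pdivrMr // lerDr mulr_ge0 // ltW.
exists eta, (expR (- Y)); split => //; first exact: expR_gt0.
move=> I U r1 r2 s cov two r1d r2d sh.
have [lo [hi [lo0 lohi hid diamU]]] := positive_scales _ _ _ _ _ (expR_gt0 _) two r1d r2d.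
have hi0 := lt_le_trans lo0 lohi.
have lnd d : 0 < d -> d <= hi -> ln d < - Y.
  move=> d0 dhi; rewrite -[X in _ < X]expRK ltr_ln ?posrE ?expR_gt0 //.
  exact: le_lt_trans hid.
have Ypos : 0 <= Y by apply: le_trans Y1; rewrite mulr_ge0 // ltW.
have le1 d : 0 < d -> d <= hi -> 0 < d <= 1.
  move=> d0 dhi; rewrite d0 -ler_ln ?posrE // ln1.
  by apply: ltW (lt_le_trans (lnd d d0 dhi) _); rewrite oppr_le0.
have [k1 /andP[k1a k1b]] := scale_of_diameter m2 mn _ (le1 hi hi0 (lexx _)).
have [k2 /andP[k2a k2b]] := scale_of_diameter m2 mn _ (le1 lo lo0 lohi).
have ks1 : (ks <= k1)%N.
  rewrite -ltnS -(ltr_nat R) -(ltr_pM2r ln0).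
  apply: le_lt_trans Y1 _; rewrite -ltrN2 -mulNr.
  exact: lt_trans k1a (lnd hi hi0 (lexx _)).
have k12 : (k1 <= k2)%N.
  rewrite -ltnS -(ltr_nat R) -(ltr_pM2r ln0).
  have ll : ln lo <= ln hi by rewrite ler_ln ?posrE.
  rewrite -ltrN2 -!mulNr.
  exact: lt_le_trans k2a (le_trans ll k1b).
pose K := col_level k2.
have [W [G [W0 Ghalf Gcyl]]] := measure k1 k2 (col_level k1) (col_level k2) K ks1 k12
  (col_levelP m2 mn k1) (col_levelP m2 mn k2) (leqnn _).
(* a representative of each set of the cover, so that the sets of diameter 0
   are singletons to be avoided *)
have /choice[c cP] : forall i, exists y, forall x, U i x -> U i y.
  move=> i; have [[x Ux]|nU] := pselect (U i !=set0); first by exists x.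
  by exists 0 => x Ux; exfalso; apply: nU; exists x.
have pick (w : {ffun 'I_K -> letter}) : exists vxi : (nat -> letter) * 'rV[R]_2 * nat,
    [/\ forall t : 'I_K, vxi.1.1 t = w t, coded A vxi.1.1 vxi.1.2,
        I vxi.2 /\ U vxi.2 vxi.1.2
      & diam (U vxi.2) = lo%:E \/ diam (U vxi.2) = hi%:E].
  have [v [vw vc]] := code_avoiding_sequence A m2 mn a b K (extend a K w) c cab.
  have [x Lx vx] := code_has_carpet_point A L m2 mn carpetL v.
  have [i Ii Ux] := cov x Lx.
  exists (v, x, i); split => //=.
    by move=> t; rewrite vw ?ltn_ord // extendE.
  have [d|d|d] := diamU i Ii; [exfalso | by left | by right].
  by apply: (vc i); rewrite -(diam0_eq _ _ _ d Ux (cP _ _ Ux)).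
have [f fP] := choice pick.
pose V w := (f w).1.1; pose X w := (f w).1.2; pose ix w := (f w).2.
pose J := undup [seq ix w | w <- enum {: {ffun 'I_K -> letter}}].
have inJ w : ix w \in J by rewrite mem_undup map_f // mem_enum.
have JP i : i \in J -> I i /\ (diam (U i) = lo%:E \/ diam (U i) = hi%:E).
  by rewrite mem_undup => /mapP[w _ ->]; have [_ _ []] := fP w.
have mass i : i \in J ->
    ((2 * \sum_(w | G w && (ix w == i)) W w)%:E <= poweR (diam (U i)) s)%E.
  move=> /JP[Ii].
  suff main (k : nat) (d : R) : 0 < d -> d <= hi -> (k, col_level k) = (k1, col_level k1) \/ (k, col_level k) = (k2, col_level k2) ->
      - (k.+1)%:R * ln n%:R < ln d <= - k%:R * ln n%:R -> diam (U i) = d%:E ->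
      ((2 * \sum_(w | G w && (ix w == i)) W w)%:E <= poweR (diam (U i)) s)%E.
    case=> dU.
      exact: (main k2 lo lo0 lohi (or_intror erefl) (introT andP (conj k2a k2b)) dU).
    exact: (main k1 hi hi0 (lexx _) (or_introl erefl) (introT andP (conj k1a k1b)) dU).
  move=> d0 dhi kk /andP[ka1 kb1] dU; rewrite dU poweR_EFin lee_fin.
  pose e := expR (- (ln_partition / al + 2 * ka) * k%:R).
  apply: (le_trans (y := 2 * (25 * e))).
    rewrite ler_wpM2l //; apply: (few_cylinders_meet K k d (U i) e V X) => //.
    - by move=> w t; have [vw _ _ _] := fP w; exact: vw.
    - by move=> w; have [] := fP w.
    - by move=> w /andP[_ /eqP <-]; have [_ _ []] := fP w.
    - exact: expR_ge0.
    - by move=> w /andP[Gw _]; exact: Gcyl.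
  have ld := lnd d d0 dhi.
  rewrite mulrA -natrM /e h'E; apply: power_ge_cylinder_mass => //.
    by apply: ltW (lt_le_trans ld _); rewrite oppr_le0.
  by apply: (le_trans Y2); rewrite ler_wpM2l ?(ltW eta0) // lerNr ltW.
apply: le_trans _ (cost_ge_sum I U s J (undup_uniq _) (fun i iJ => (JP i iJ).1)).
apply: (le_trans (y := (\sum_(i <- J) 2 * \sum_(w | G w && (ix w == i)) W w)%:E)).
  rewrite lee_fin -mulr_sumr (sum_over_values _ _ J ix G W (undup_uniq _)).
  rewrite (eq_bigl G); last by move=> w; rewrite inJ andbT.
  by rewrite mulrC -ler_pdivrMr // mul1r.
by rewrite -sumEFin big_seq [X in (_ <= X)%E]big_seq; apply: lee_sum.
Qed.

End LowerBound.

Theorem corollary2p2 (R : realType) (m n : nat) (A : {set 'I_m * 'I_n})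
    (L : set 'rV[R]_2) :
  (2 <= m)%N -> (m < n)%N ->
  A != finset.set0 ->
  (1 < #|nonempty_columns A|)%N ->
  non_uniform_fibres A ->
  is_carpet A L ->
  exists theta0 eps delta0 : R,
    [/\ 0 < theta0, 0 < eps, 0 < delta0
      & forall theta : R, 0 < theta < theta0 ->
        forall (I : set nat) (U : nat -> set 'rV[R]_2) (a b : R),
          covers L I U ->
          at_most_two_scales I U a b ->
          a < delta0 -> b < delta0 ->
          (1 <= cost I U (intermediate_dim theta L + eps))%E].
Proof.
move=> m2 mn _ _ nu carpetL.
have [a [b [fab cab]]] := @non_uniform_letters R m n A nu.
have [eta [delta0 [eta0 delta00 low]]] := two_scale_cost A L m2 mn carpetL a b fab cab.
have [theta0 theta00 up] := upper_dim_le A L m2 mn carpetL a (eta / 2) (divr_gt0 eta0 (ltr0Sn R 1)).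
exists theta0, (eta / 2), delta0; split => // [|theta th I U r1 r2 cov two r1d r2d].
  by rewrite divr_gt0.
have dim_le : intermediate_dim theta L + eta / 2 <= ln_partition (@col_of m n A) (@ratio R m n) / ln m%:R + eta.
  by have := up theta th; rewrite /intermediate_dim; lra.
exact: low cov two r1d r2d dim_le.
Qed.
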